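(* Let $k$ be a field of characteristic zero and $A=k[x_1][x_2;\alpha_2,\delta_2]_p\cdots[x_n;\alpha_n,\delta_n]_p$ an iterated Poisson polynomial algebra such that (a) $\delta_i$ is locally nilpotent for all $i$; (b) there exist $s_i\in k^\times$ with $\alpha_i\delta_i=\delta_i(\alpha_i+s_i)$ for all $i$; (c) there exist $\lambda_{ij}\in k$ with $\alpha_i(x_j)=\lambda_{ij}x_j$ for all $i>j$. Let ${\boldsymbol\lambda}=(\lambda_{ij})$ be the antisymmetric matrix in $M_n(k)$ whose entries below the diagonal are the scalars in (c). Then: (1) $\operatorname{Fract}A\cong k_{\boldsymbol\lambda}(y_1,\dots,y_n)$ as Poisson algebras. (2) For any Poisson prime ideal $P$ of $A$, there exist a field extension $K\supseteq k$ and an antisymmetric ${\boldsymbol\mu}\in M_m(k)$, for some $m\le n$, such that $\operatorname{Fract}A/P\cong K_{\boldsymbol\mu}(y_1,\dots,y_m)$ as Poisson algebras; in fact ${\boldsymbol\mu}$ is the upper left $m\times m$ submatrix of ${\boldsymbol\sigma}{\boldsymbol\lambda}{\boldsymbol\sigma}^{\mathrm{tr}}$ for some ${\boldsymbol\sigma}\in GL_n(\mathbb Z)$.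
   Context: If $B$ is a Poisson algebra, $\alpha$ a Poisson derivation of $B$ and $\delta$ a derivation of $B$ with $\delta(\{a,b\})=\{\delta(a),b\}+\{a,\delta(b)\}+\alpha(a)\delta(b)-\delta(a)\alpha(b)$, then $B[x;\alpha,\delta]_p$ is $B[x]$ with the unique Poisson bracket extending that of $B$ with $\{x,b\}=\alpha(b)x+\delta(b)$; an iterated Poisson polynomial algebra iterates this starting from $k[x_1]$ with zero bracket. For a field $K\supseteq k$ and antisymmetric ${\boldsymbol\mu}\in M_m(k)$, $K_{\boldsymbol\mu}(y_1,\dots,y_m)$ is the rational function field over $K$ with the unique $K$-linear Poisson bracket satisfying $\{y_i,y_j\}=\mu_{ij}y_iy_j$. A Poisson prime ideal is a prime ideal $P$ with $\{A,P\}\subseteq P$; the bracket extends uniquely to quotient fields. *)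

(* Defs.v *)
From HB Require Import structures.
From mathcomp Require Import all_boot all_order all_algebra.
From mathcomp Require Export mpoly.
Set Implicit Arguments.
Unset Strict Implicit.
Unset Printing Implicit Defensive.
Import Order.TTheory GRing.Theory Num.Theory.
Local Open Scope ring_scope.

(* Poisson brackets.  [s : S -> R] embeds the scalars S; the bracket is    *)
(* S-linear in the first argument (hence S-bilinear by antisymmetry),      *)
(* antisymmetric, satisfies Jacobi and the Leibniz rule.                   *)
Definition poisson_bracket (R : comRingType) (S : Type) (s : S -> R)
    (br : R -> R -> R) : Prop :=
  [/\ (forall (c : S) (a b d : R), br (s c * a + b) d = s c * br a d + br b d),
      (forall a b : R, br a b = - br b a),
      (forall a b c : R, br a (br b c) + br b (br c a) + br c (br a b) = 0) &
      (forall a b c : R, br a (b * c) = br a b * c + b * br a c)].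

Definition poisson_iso (k : Type) (R1 R2 : comRingType) (s1 : k -> R1)
    (s2 : k -> R2) (br1 : R1 -> R1 -> R1) (br2 : R2 -> R2 -> R2)
    (f : R1 -> R2) : Prop :=
  [/\ bijective f,
      (forall a b, f (a + b) = f a + f b) /\ (forall a b, f (a * b) = f a * f b)
        /\ f 1 = 1,
      (forall c, f (s1 c) = s2 c) &
      (forall a b, f (br1 a b) = br2 (f a) (f b))].

Definition ratfun (K : fieldType) (m : nat) : fieldType :=
  {fraction {mpoly K[m]}}.

Definition ratfunC (K : fieldType) (m : nat) (c : K) : ratfun K m :=
  @FracField.tofrac _ (c%:MP).

Definition ratfunY (K : fieldType) (m : nat) (i : 'I_m) : ratfun K m :=
  @FracField.tofrac _ ('X_i).

(* [br] is the bracket of K_mu(y_1,...,y_m): the (unique) K-linear Poisson *)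
(* bracket with {y_i, y_j} = mu_ij y_i y_j.                                *)
Definition qtorus_bracket (K : fieldType) (m : nat) (mu : 'M[K]_m)
    (br : ratfun K m -> ratfun K m -> ratfun K m) : Prop :=
  poisson_bracket (@ratfunC K m) br /\
  (forall i j : 'I_m,
     br (@ratfunY K m i) (@ratfunY K m j)
     = @ratfunC K m (mu i j) * @ratfunY K m i * @ratfunY K m j).

(* Iterated Poisson polynomial algebras on the polynomial ring             *)
(* A = k[x_1,...,x_n] = {mpoly k[n]} (variable x_{i+1} is 'X_i, i : 'I_n). *)

Definition lower_vars (k : fieldType) (n i : nat) (p : {mpoly k[n]}) : Prop :=
  forall mo : 'X_{1..n}, mo \in msupp p ->
    forall j : 'I_n, (i <= j)%N -> mo j = 0%N.

Definition derivation_on (k : fieldType) (n : nat) (B : {mpoly k[n]} -> Prop)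
    (d : {mpoly k[n]} -> {mpoly k[n]}) : Prop :=
  [/\ (forall a, B a -> B (d a)),
      (forall (c : k) a b, B a -> B b -> d (c *: a + b) = c *: d a + d b) &
      (forall a b, B a -> B b -> d (a * b) = d a * b + a * d b)].

Definition poisson_derivation_on (k : fieldType) (n : nat)
    (br : {mpoly k[n]} -> {mpoly k[n]} -> {mpoly k[n]})
    (B : {mpoly k[n]} -> Prop) (d : {mpoly k[n]} -> {mpoly k[n]}) : Prop :=
  derivation_on B d /\
  (forall a b, B a -> B b -> d (br a b) = br (d a) b + br a (d b)).

(* A = k[x_1][x_2;alpha_2,delta_2]_p ... [x_n;alpha_n,delta_n]_p with the  *)
(* bracket br, where alpha i, delta i (i : 'I_n) are the data attached to  *)
(* the variable 'X_i and act on B_i = k[x_1,...,x_i] (= k for i = 0).      *)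
Definition iterated_poisson_poly (k : fieldType) (n : nat)
    (br : {mpoly k[n]} -> {mpoly k[n]} -> {mpoly k[n]})
    (alpha delta : 'I_n -> {mpoly k[n]} -> {mpoly k[n]}) : Prop :=
  poisson_bracket (fun c : k => c%:MP) br /\
  forall i : 'I_n,
    [/\ poisson_derivation_on br (@lower_vars k n i) (alpha i),
        derivation_on (@lower_vars k n i) (delta i),
        (forall a b, lower_vars i a -> lower_vars i b ->
           delta i (br a b) = br (delta i a) b + br a (delta i b)
                              + alpha i a * delta i b - delta i a * alpha i b) &
        (forall b, lower_vars i b ->
           br 'X_i b = alpha i b * 'X_i + delta i b)].

Definition poisson_prime_ideal (R : comRingType) (br : R -> R -> R)
    (P : R -> Prop) : Prop :=
  [/\ P 0 /\ (forall a b, P a -> P b -> P (a + b)),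
      (forall a b, P b -> P (a * b)),
      ~ P 1,
      (forall a b, P (a * b) -> P a \/ P b) &
      (forall a b, P b -> P (br a b))].

(* Main.v *)
Require Import Defs.
From HB Require Import structures.
From mathcomp Require Import all_boot all_order all_fingroup all_algebra.
From mathcomp Require Import mpoly ring zify generic_quotient.
From Stdlib Require Import ClassicalEpsilon.
Set Implicit Arguments.
Unset Strict Implicit.
Unset Printing Implicit Defensive.
Import GRing.Theory Num.Theory.
Local Open Scope ring_scope.

(* Let L be Fract A or Fract A/P.  The derivations delta_i are deleted one at a
   time, from i = n down to 1, inside L.  If x is the current image of x_i and
   x <> 0, then theta(b) = sum_r (1/r!) (-1/(s_i x))^r delta_i^r(b) is a Poisson
   homomorphism on the algebra generated by the lower variables, it satisfies
   {x, theta(b)} = theta(alpha_i(b)) x, and the theta(x_j) together with x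
   generate the same field as the x_j and x.  If x = 0 there is nothing to do.
   In the end L is generated by w_1, ..., w_n with {w_i, w_j} = lambda_ij w_i w_j.
   For L = Fract A the w_i are independent because a derivation is determined by
   its values on them, so that their Jacobian is invertible.  For Fract A/P,
   discard the w_i that vanish and take K to be the Poisson center of L.  A basis
   of the lattice of Laurent monomials adapted to the radical of lambda consists
   of central monomials and of y_1, ..., y_m whose monomials have distinct weights
   under the {-, w_j}; hence the y_i are independent over K. *)

(** * Polynomials in the first [t] variables *)

Section LowerVars.
Variables (k : fieldType) (n : nat).
Implicit Types (a b p : {mpoly k[n]}).

Lemma lower_varsC (t : nat) (c : k) : lower_vars t (c%:MP : {mpoly k[n]}).
Proof.
move=> m; rewrite msuppC; case: eqP => // _.
by rewrite inE => /eqP -> j _; rewrite mnm0E.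
Qed.

Lemma lower_varsX (t : nat) (j : 'I_n) :
  (j < t)%N -> lower_vars t ('X_j : {mpoly k[n]}).
Proof.
move=> jt m; rewrite msuppX inE => /eqP -> l tl; rewrite mnm1E.
by case: eqP => // jl; move: jt; rewrite jl ltnNge tl.
Qed.

Lemma lower_varsD (t : nat) a b :
  lower_vars t a -> lower_vars t b -> lower_vars t (a + b).
Proof.
by move=> la lb m /msuppD_le; rewrite mem_cat => /orP[/la|/lb].
Qed.

Lemma lower_varsM (t : nat) a b :
  lower_vars t a -> lower_vars t b -> lower_vars t (a * b).
Proof.
move=> la lb m /msuppM_le /allpairsP[[m1 m2] /= [/la h1 /lb h2 ->]] j tj.
by rewrite mnmDE h1 // h2.
Qed.

Lemma lower_varsZ (t : nat) (c : k) a : lower_vars t a -> lower_vars t (c *: a).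
Proof. by rewrite -mul_mpolyC => la; apply: lower_varsM => //; apply: lower_varsC. Qed.

Lemma lower_varsN (t : nat) a : lower_vars t a -> lower_vars t (- a).
Proof. by rewrite -scaleN1r; apply: lower_varsZ. Qed.

Lemma lower_varsW (t t' : nat) a :
  (t <= t')%N -> lower_vars t a -> lower_vars t' a.
Proof. by move=> tt' la m /la h j t'j; apply/h/(leq_trans tt'). Qed.

Lemma lower_varsT a : lower_vars n a.
Proof. by move=> m _ j; rewrite leqNgt ltn_ord. Qed.

(** Monomials in the support of [p] have exponent 0 at every variable of index at least [t]. The sum
    and product cases retain the membership of both terms, because [derivation_on] gives its laws
    only inside the subalgebra. *)
Lemma lower_vars_ind (t : nat) (Q : {mpoly k[n]} -> Prop) :
    (forall c : k, Q c%:MP) ->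
    (forall j : 'I_n, (j < t)%N -> Q 'X_j) ->
    (forall a b, lower_vars t a -> lower_vars t b -> Q a -> Q b -> Q (a + b)) ->
    (forall a b, lower_vars t a -> lower_vars t b -> Q a -> Q b -> Q (a * b)) ->
  forall p, lower_vars t p -> Q p.
Proof.
move=> QC QX QD QM p lp.
pose Q' q := lower_vars t q /\ Q q.
suff [] : Q' p by [].
have Q'M a b : Q' a -> Q' b -> Q' (a * b).
  by move=> [la Qa] [lb Qb]; split; [apply: lower_varsM | apply: QM].
have Q'C c : Q' c%:MP by split; [apply: lower_varsC | apply: QC].
have Q'1 : Q' 1 by rewrite -mpolyC1; apply: Q'C.
rewrite (mpolyE p) big_seq; apply: big_ind => [||m mp].
- by rewrite -mpolyC0; apply: Q'C.
- by move=> a b [la Qa] [lb Qb]; split; [apply: lower_varsD | apply: QD].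
rewrite -mul_mpolyC mpolyXE_id; apply: (Q'M) => //; apply: big_ind => // j _.
case: (ltnP j t) => jt; last by rewrite (lp _ mp) // expr0.
elim: (m j) => [|e IH]; first by rewrite expr0.
by rewrite exprS; apply: (Q'M) => //; split; [apply: lower_varsX | apply: QX].
Qed.

End LowerVars.

(** * Derivations, eigenvectors and subfields *)

Definition is_der (R : nzRingType) (D : R -> R) : Prop :=
  (forall a b, D (a + b) = D a + D b) /\
  (forall a b, D (a * b) = D a * b + a * D b).

Definition subfield_pred (L : fieldType) (F : L -> Prop) : Prop :=
  [/\ F 1, (forall a b, F a -> F b -> F (a - b)),
      (forall a b, F a -> F b -> F (a * b)) & (forall a, F a -> F a^-1)].

Section SubfieldPred.
Variables (L : fieldType) (F : L -> Prop).
Hypothesis sF : subfield_pred F.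

Lemma subfield_pred0 : F 0.
Proof. by case: sF => F1 FB _ _; rewrite -(subrr 1); apply: FB. Qed.

Lemma subfield_predN a : F a -> F (- a).
Proof. by case: sF => _ FB _ _ Fa; rewrite -sub0r; apply: FB => //; apply: subfield_pred0. Qed.

Lemma subfield_predD a b : F a -> F b -> F (a + b).
Proof.
by case: sF => _ FB _ _ Fa Fb; rewrite -[b]opprK; apply: FB => //; apply: subfield_predN.
Qed.

Lemma subfield_predX a (e : nat) : F a -> F (a ^+ e).
Proof.
case: sF => F1 _ FM _ Fa; elim: e => [|e IH]; first by rewrite expr0.
by rewrite exprS; apply: FM.
Qed.

Lemma subfield_predXz a (e : int) : F a -> F (a ^ e).
Proof.
by move=> Fa; case: e => e; [|case: sF => _ _ _ FV; apply: FV]; apply: subfield_predX.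
Qed.

Lemma subfield_pred_sum (I : Type) (r : seq I) (P : pred I) (f : I -> L) :
  (forall i, P i -> F (f i)) -> F (\sum_(i <- r | P i) f i).
Proof. by apply: big_ind; [apply: subfield_pred0 | apply: subfield_predD]. Qed.

Lemma subfield_pred_prod (I : Type) (r : seq I) (P : pred I) (f : I -> L) :
  (forall i, P i -> F (f i)) -> F (\prod_(i <- r | P i) f i).
Proof. by case: sF => F1 _ FM _; apply: big_ind. Qed.

Lemma subfield_pred_mmap (R : nzRingType) (n : nat) (i : R -> L) (h : 'I_n -> L) p :
  (forall c, F (i c)) -> (forall j, F (h j)) -> F (mmap i h p).
Proof.
case: (sF) => F1 _ FM _ Fi Fh; apply: subfield_pred_sum => m _; apply: FM => //.
by apply: subfield_pred_prod => j _; apply: subfield_predX.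
Qed.

End SubfieldPred.

Section Derivation.
Variables (R : comNzRingType) (D : R -> R).
Hypothesis dD : is_der D.

Lemma derD a b : D (a + b) = D a + D b. Proof. by case: dD. Qed.
Lemma derM a b : D (a * b) = D a * b + a * D b. Proof. by case: dD. Qed.

Lemma der0 : D 0 = 0.
Proof. by apply: (@addrI _ (D 0)); rewrite -derD !addr0. Qed.

Lemma der1 : D 1 = 0.
Proof.
by apply: (@addrI _ (D 1)); have := derM 1 1; rewrite !mulr1 mul1r addr0 => <-.
Qed.

Lemma derN a : D (- a) = - D a.
Proof. by apply/eqP; rewrite -addr_eq0 -derD addNr der0. Qed.

Lemma der_sum (I : Type) (r : seq I) (P : pred I) (f : I -> R) :
  D (\sum_(i <- r | P i) f i) = \sum_(i <- r | P i) D (f i).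
Proof. exact: (big_morph D derD der0). Qed.

Lemma derX a (e : nat) : D (a ^+ e) = a ^+ e.-1 * D a *+ e.
Proof.
elim: e => [|[|e] IH]; first by rewrite expr0 der1.
  by rewrite expr1 expr0 mul1r.
by rewrite exprS derM IH /= !mulrS exprS; ring.
Qed.

Lemma der_eigenM (c d a b : R) :
  D a = c * a -> D b = d * b -> D (a * b) = (c + d) * (a * b).
Proof. by move=> Da Db; rewrite derM Da Db; ring. Qed.

Lemma der_eigenX (c a : R) (e : nat) : D a = c * a -> D (a ^+ e) = c *+ e * a ^+ e.
Proof.
move=> Da; elim: e => [|e IH]; first by rewrite expr0 der1 mulr0n mul0r.
by rewrite exprS (der_eigenM Da IH) mulrS.
Qed.

Lemma der_eigen_prod (I : Type) (r : seq I) (c f : I -> R) :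
  (forall i, D (f i) = c i * f i) ->
  D (\prod_(i <- r) f i) = (\sum_(i <- r) c i) * \prod_(i <- r) f i.
Proof.
move=> Df; elim: r => [|i r IH]; first by rewrite !big_nil der1 mul0r.
by rewrite !big_cons (der_eigenM (Df i) IH).
Qed.

End Derivation.

Section FieldDerivation.
Variables (L : fieldType) (D : L -> L).
Hypothesis dD : is_der D.

Lemma derV a : D a^-1 = - D a / a ^+ 2.
Proof.
have [->|a0] := eqVneq a 0; first by rewrite invr0 (der0 dD) oppr0 mul0r.
have := derM dD a a^-1; rewrite divff // (der1 dD) => /esym/eqP.
rewrite addrC addr_eq0 => /eqP h.
by apply: (mulfI a0); rewrite h; field.
Qed.

Lemma der_eigenV (c a : L) : D a = c * a -> D a^-1 = - c * a^-1.
Proof.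
move=> Da; have [->|a0] := eqVneq a 0; first by rewrite invr0 (der0 dD) mulr0.
by rewrite derV Da; field.
Qed.

Lemma der_eigenXz (c a : L) (e : int) : D a = c * a -> D (a ^ e) = c *~ e * a ^ e.
Proof.
move=> Da; case: e => e; first exact: der_eigenX.
by rewrite NegzE mulrNz -exprnN (der_eigenV (der_eigenX dD e.+1 Da)).
Qed.

(** With [generates], this shows that a derivation killing the scalars and a generating family is
    zero. *)
Lemma subfield_pred_ker : subfield_pred (fun z => D z = 0).
Proof.
split=> [|a b Da Db|a b Da Db|a Da]; first exact: der1.
- by rewrite (derD dD) (derN dD) Da Db subr0.
- by rewrite (derM dD) Da Db mul0r mulr0 addr0.
- by rewrite derV Da oppr0 mul0r.
Qed.

End FieldDerivation.

(** * Brackets as derivations in each argument *)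

Section Poisson.
Variables (k : nzRingType) (R : comNzRingType) (iR : {rmorphism k -> R}).
Variable br : R -> R -> R.
Hypothesis pbr : poisson_bracket iR br.

Lemma brC a b : br a b = - br b a. Proof. by case: pbr. Qed.

Lemma br_der a : is_der (br a).
Proof.
case: pbr => lin anti _ leib; split=> b c; last exact: leib.
rewrite anti; have := lin 1 b c a; rewrite rmorph1 !mul1r => ->.
by rewrite opprD -!anti.
Qed.

Lemma br_derl a : is_der (br ^~ a).
Proof.
have [D M] := br_der a; split=> b c.
- by rewrite brC D opprD -!brC.
- by rewrite brC M [br b a]brC [br c a]brC; ring.
Qed.

Lemma br_const (c : k) a : br a (iR c) = 0.
Proof.
case: pbr => lin _ _ _; rewrite brC; have := lin c 1 0 a.
rewrite addr0 mulr1 (der0 (br_derl a)) addr0 (der1 (br_derl a)) mulr0 => ->.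
exact: oppr0.
Qed.

(** Antisymmetry alone gives only [2 {a,a} = 0]. *)
Lemma br_self a : GRing.lreg (2%:R : R) -> br a a = 0.
Proof.
move=> two; apply: two; rewrite mulr0 mulr_natl mulr2n {1}brC addNr //.
Qed.

End Poisson.

(** Phrased through predicates so that it serves directly as an induction principle, without writing
    elements as fractions. *)
Definition generates (k L : fieldType) (iL : k -> L) (I : Type) (w : I -> L) :=
  forall F : L -> Prop, subfield_pred F -> (forall c, F (iL c)) ->
    (forall i, F (w i)) -> forall z, F z.

(** * Derivations defined on a subalgebra *)

Section DerivationOn.
Variables (k : fieldType) (n : nat).
Local Notation A := {mpoly k[n]}.
Variables (B : A -> Prop) (d : A -> A).
Hypotheses (BC : forall c : k, B c%:MP) (dd : derivation_on B d).

Lemma derivation_onD a b : B a -> B b -> d (a + b) = d a + d b.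
Proof.
by case: dd => _ h _ Ba Bb; have := h 1 a b Ba Bb; rewrite !scale1r.
Qed.

Lemma derivation_onM a b : B a -> B b -> d (a * b) = d a * b + a * d b.
Proof. by case: dd => _ _; apply. Qed.

Lemma derivation_on0 : d 0 = 0.
Proof.
case: dd => _ h _; have B0 : B 0 by rewrite -mpolyC0.
by have := h (-1) 0 0 B0 B0; rewrite scaler0 addr0 scaleN1r addNr.
Qed.

Lemma derivation_onZ c a : B a -> d (c *: a) = c *: d a.
Proof.
move=> Ba; case: (dd) => _ h _; have B0 : B 0 by rewrite -mpolyC0.
by have := h c a 0 Ba B0; rewrite derivation_on0 !addr0.
Qed.

Lemma derivation_onC c : d c%:MP = 0.
Proof.
have B1 : B 1 by rewrite -mpolyC1.
have d1 : d 1 = 0.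
  have := derivation_onM B1 B1; rewrite !mulr1 mul1r => h.
  by apply: (@addrI _ (d 1)); rewrite -h addr0.
by rewrite -[c%:MP]mulr1 mul_mpolyC derivation_onZ // d1 scaler0.
Qed.

End DerivationOn.

(** * Extending a bracket to polynomials in a central variable *)

Section PolyBracket.
Variables (L : fieldType) (br : L -> L -> L).
Hypothesis (br_der : forall a, is_der (br a)).
Hypothesis (br_derl : forall a, is_der (br ^~ a)).
Implicit Types p q : {poly L}.

Lemma poly_additive_eq (V : zmodType) (f g : {poly L} -> V) :
    {morph f : p q / p + q} -> {morph g : p q / p + q} ->
    (forall c i, f (c *: 'X^i) = g (c *: 'X^i)) -> f =1 g.
Proof.
move=> fD gD fg p.
have f0 : f 0 = 0 by apply: (@addrI _ (f 0)); rewrite -fD !addr0.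
have g0 : g 0 = 0 by apply: (@addrI _ (g 0)); rewrite -gD !addr0.
rewrite -[p]coefK poly_def (big_morph f fD f0) (big_morph g gD g0).
by apply: eq_bigr => i _.
Qed.

(* The bracket of [L] extended to [L[T]] so that [T] is central. *)
Definition poly_br p q : {poly L} :=
  \sum_(i < size p) \sum_(j < size q) br p`_i q`_j *: 'X^(i + j).

(** A common bound for both sums makes additivity termwise; the added terms vanish because a bracket
    with 0 does. *)
Lemma poly_brE N p q : (size p <= N)%N -> (size q <= N)%N ->
  poly_br p q = \sum_(i < N) \sum_(j < N) br p`_i q`_j *: 'X^(i + j).
Proof.
move=> hp hq; rewrite /poly_br (big_ord_widen _
  (fun i => \sum_(j < size q) br p`_i q`_j *: 'X^(i + j)) hp).
rewrite big_mkcond; apply: eq_bigr => i _.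
rewrite (big_ord_widen _ (fun j => br p`_i q`_j *: 'X^(i + j)) hq) big_mkcond.
case: ltnP => [_|pi]; last first.
  by rewrite big1 // => j _; rewrite nth_default // (der0 (br_derl _)) scale0r.
apply: eq_bigr => j _; case: ltnP => // qj.
by rewrite [q`_j]nth_default // (der0 (br_der _)) scale0r.
Qed.

Lemma poly_brDl q : {morph poly_br^~ q : p p' / p + p'}.
Proof.
move=> p p' /=; pose N := maxn (maxn (size p) (size p')) (size q).
have hp : (size p <= N)%N by rewrite !leq_max leqnn.
have hp' : (size p' <= N)%N by rewrite !leq_max leqnn orbT.
have hq : (size q <= N)%N by rewrite leq_max leqnn orbT.
have hpp : (size (p + p')%R <= N)%N.
  by rewrite (leq_trans (size_polyD _ _)) // geq_max hp.
rewrite !(@poly_brE N) // -big_split; apply: eq_bigr => i _ /=.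
rewrite -big_split; apply: eq_bigr => j _ /=.
by rewrite coefD (derD (br_derl _)) scalerDl.
Qed.

Lemma poly_brDr p : {morph poly_br p : q q' / q + q'}.
Proof.
move=> q q' /=; pose N := maxn (maxn (size q) (size q')) (size p).
have hq : (size q <= N)%N by rewrite !leq_max leqnn.
have hq' : (size q' <= N)%N by rewrite !leq_max leqnn orbT.
have hp : (size p <= N)%N by rewrite leq_max leqnn orbT.
have hqq : (size (q + q')%R <= N)%N.
  by rewrite (leq_trans (size_polyD _ _)) // geq_max hq.
rewrite !(@poly_brE N) // -big_split; apply: eq_bigr => i _ /=.
rewrite -big_split; apply: eq_bigr => j _ /=.
by rewrite coefD (derD (br_der _)) scalerDl.
Qed.

Lemma poly_br0l q : poly_br 0 q = 0.
Proof. by rewrite /poly_br size_poly0 big_ord0. Qed.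

Lemma poly_br0r p : poly_br p 0 = 0.
Proof. by rewrite /poly_br size_poly0; apply: big1 => i _; rewrite big_ord0. Qed.

Lemma poly_br_monom c i d j :
  poly_br (c *: 'X^i) (d *: 'X^j) = br c d *: 'X^(i + j).
Proof.
pose N := (maxn i j).+1.
have hi : (i < N)%N by rewrite ltnS leq_maxl.
have hj : (j < N)%N by rewrite ltnS leq_maxr.
have sz e l : (l < N)%N -> (size (e *: 'X^l : {poly L}) <= N)%N.
  by move=> lN; rewrite (leq_trans (size_scale_leq _ _)) // size_polyXn.
rewrite (@poly_brE N) ?sz //.
rewrite (bigD1 (Ordinal hi)) //= [X in _ + X]big1 => [|i' ii']; last first.
  apply: big1 => j' _; rewrite coefZ coefXn -val_eqE /= in ii' *.
  by rewrite (negPf ii') mulr0 (der0 (br_derl _)) scale0r.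
rewrite addr0 (bigD1 (Ordinal hj)) //= [X in _ + X]big1 => [|j' jj']; last first.
  rewrite (coefZ d) coefXn -val_eqE /= in jj' *.
  by rewrite (negPf jj') mulr0 (der0 (br_der _)) scale0r.
by rewrite addr0 !coefZ !coefXn !eqxx !mulr1.
Qed.

(** On monomials all terms carry the same bracket of coefficients, and the factor [i + j] coming
    from ['X^(i + j)] splits into the two summands. *)
Lemma deriv_poly_br p q :
  (poly_br p q)^`() = poly_br p^`() q + poly_br p q^`().
Proof.
move: p; apply: poly_additive_eq => [p p'|p p'|c i].
- by rewrite poly_brDl derivD.
- by rewrite derivD !poly_brDl addrACA.
move: q; apply: poly_additive_eq => [q q'|q q'|d j].
- by rewrite poly_brDr derivD.
- by rewrite derivD !poly_brDr addrACA.
rewrite poly_br_monom !derivZ !derivXn.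
have bMn p q e : poly_br p (q *+ e) = poly_br p q *+ e.
  elim: e => [|e IH]; first by rewrite !mulr0n poly_br0r.
  by rewrite !mulrS poly_brDr IH.
have bMn' p q e : poly_br (p *+ e) q = poly_br p q *+ e.
  elim: e => [|e IH]; first by rewrite !mulr0n poly_br0l.
  by rewrite !mulrS poly_brDl IH.
rewrite -!scalerMnr bMn bMn' !poly_br_monom.
case: i j => [|i] [|j]; rewrite ?addn0 ?mulr0n ?addr0 ?add0r //.
by rewrite /= !addSn !addnS /= -mulrnDr addSn addnS.
Qed.

Definition coef_br t p : {poly L} := \poly_(i < size p) br t p`_i.

Lemma coef_coef_br t p i : (coef_br t p)`_i = br t p`_i.
Proof.
rewrite coef_poly; case: ltnP => // pi.
by rewrite nth_default // (der0 (br_der _)).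
Qed.

Lemma coef_brD t : {morph coef_br t : p q / p + q}.
Proof.
by move=> p q; apply/polyP=> i; rewrite coefD !coef_coef_br coefD (derD (br_der _)).
Qed.

Lemma coef_br_monom t c i : coef_br t (c *: 'X^i) = br t c *: 'X^i.
Proof.
apply/polyP=> j; rewrite coef_coef_br !coefZ coefXn.
by case: eqP; rewrite ?mulr1 // !mulr0 (der0 (br_der _)).
Qed.

(** Chain rule: besides the bracket of coefficients with coefficients, [t] from one factor meets the
    coefficients of the other, while [t] against [t] contributes nothing. *)
Lemma br_horner t p q : br t t = 0 -> (forall a b, br a b = - br b a) ->
  br p.[t] q.[t] = (poly_br p q).[t] + p^`().[t] * (coef_br t q).[t]
                   - q^`().[t] * (coef_br t p).[t].
Proof.
move=> btt anti; move: p; apply: poly_additive_eq => [p p'|p p'|c i].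
- by rewrite hornerD (derD (br_derl _)).
- by rewrite poly_brDl derivD coef_brD !hornerD; ring.
move: q; apply: poly_additive_eq => [q q'|q q'|d j].
- by rewrite hornerD (derD (br_der _)).
- by rewrite poly_brDr derivD coef_brD !hornerD; ring.
rewrite poly_br_monom !coef_br_monom !derivZ !derivXn !hornerZ.
rewrite !hornerMn !hornerXn.
have btij : br (t ^+ i) (t ^+ j) = 0.
  by rewrite (derX (br_der _)) (derX (br_derl _)) btt !(mulr0, mul0rn).
rewrite (derM (br_der _)) !(derM (br_derl _)) btij.
rewrite (derX (br_der _)) (derX (br_derl _)) [br c t]anti exprD; ring.
Qed.

Lemma br_hornerr t q : br t t = 0 -> br t q.[t] = (coef_br t q).[t].
Proof.
move=> btt; move: q; apply: poly_additive_eq => [q q'|q q'|d j].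
- by rewrite hornerD (derD (br_der _)).
- by rewrite coef_brD hornerD.
rewrite coef_br_monom !hornerZ hornerXn (derM (br_der _)) (derX (br_der _)).
by rewrite btt mulr0 mul0rn mulr0 addr0.
Qed.

End PolyBracket.

(** The tool for identities between exponential polynomials: differentiation turns them into
    identities for [delta a] and [delta b], and a check of constant terms remains. *)
Lemma deriv_inj0 (L : fieldType) (p q : {poly L}) :
    (forall m, m.+1%:R != 0 :> L) -> p^`() = q^`() -> p`_0 = q`_0 -> p = q.
Proof.
move=> char0 dpq pq0; apply/polyP => -[//|i].
have := congr1 (fun r : {poly L} => r`_i) dpq; rewrite !coef_deriv.
by rewrite -[p`_i.+1 *+ _]mulr_natl -[q`_i.+1 *+ _]mulr_natl => /(mulfI (char0 i)).
Qed.

(** * Deleting one derivation by an exponential *)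

Section DeletingDerivation.
Variables (k : fieldType) (n : nat) (L : fieldType) (iL : {rmorphism k -> L}).
Local Notation A := {mpoly k[n]}.
Variables (brA : A -> A -> A) (brL : L -> L -> L) (B : A -> Prop).
Variables (alpha delta : A -> A) (s : k) (psi : {rmorphism A -> L}) (x : L).
Hypothesis char0 : forall m, m.+1%:R != 0 :> L.
Hypothesis pbrL : poisson_bracket iL brL.
Hypothesis pbrA : poisson_bracket (fun c : k => c%:MP) brA.
Hypotheses (BC : forall c : k, B c%:MP)
  (BD : forall a b, B a -> B b -> B (a + b))
  (BM : forall a b, B a -> B b -> B (a * b))
  (Bbr : forall a b, B a -> B b -> B (brA a b)).
Hypotheses (dalpha : derivation_on B alpha) (ddelta : derivation_on B delta).
Hypothesis delta_br : forall a b, B a -> B b ->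
  delta (brA a b) = brA (delta a) b + brA a (delta b)
                    + alpha a * delta b - delta a * alpha b.
Hypothesis nilp : forall b, B b -> exists N, iter N delta b = 0.
Hypothesis s_neq0 : s != 0.
Hypothesis alpha_delta : forall b, B b -> alpha (delta b) = delta (alpha b + s *: b).
Hypothesis psiC : forall c : k, psi c%:MP = iL c.
Hypothesis psi_br : forall a b, B a -> B b -> psi (brA a b) = brL (psi a) (psi b).
Hypothesis x_neq0 : x != 0.
Hypothesis br_x : forall b, B b -> brL x (psi b) = psi (alpha b) * x + psi (delta b).

Let br_r := br_der pbrL.
Let br_l := br_derl pbrL.

Let B0 : B 0. Proof. by rewrite -mpolyC0; apply: BC. Qed.
Let BZ c a : B a -> B (c *: a).
Proof. by move=> Ba; rewrite -mul_mpolyC; apply: BM. Qed.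
Let BN a : B a -> B (- a).
Proof. by move=> Ba; rewrite -scaleN1r; apply: BZ. Qed.
Let Ba a : B a -> B (alpha a). Proof. by case: dalpha => h _ _; apply: h. Qed.
Let Bd a : B a -> B (delta a). Proof. by case: ddelta => h _ _; apply: h. Qed.
Let Biter a i : B a -> B (iter i delta a).
Proof. by move=> Baa; elim: i => //= i; apply: Bd. Qed.

Let deltaD := derivation_onD ddelta.
Let deltaM := derivation_onM ddelta.
Let delta0 := derivation_on0 BC ddelta.
Let deltaZ := derivation_onZ BC ddelta.
Let deltaC := derivation_onC BC ddelta.
Let iterL c a b i : B a -> B b ->
  iter i delta (c *: a + b) = c *: iter i delta a + iter i delta b.
Proof.
move=> Baa Bbb; elim: i => //= i ->.
by case: ddelta => _ h _; apply: h; apply: Biter.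
Qed.
Let iter0 i : iter i delta 0 = 0. Proof. by elim: i => //= i ->. Qed.

(** Chosen by [epsilon] so that [exp_poly] is total; it is guaranteed to be a nilpotency bound only
    for [b] in [B]. *)
Let N (b : A) : nat := epsilon (inhabits 0%N) (fun m => iter m delta b = 0).

(** This is [psi (exp (T delta) b)], a polynomial in [T] by local nilpotency. *)
Definition exp_poly b : {poly L} :=
  \poly_(i < N b) (psi (iter i delta b) / i`!%:R).
Local Notation E := exp_poly.

Let fact_neq0 i : i`!%:R != 0 :> L.
Proof. by rewrite -[i`!]prednK ?fact_gt0. Qed.

Lemma coef_exp_poly b i : B b -> (E b)`_i = psi (iter i delta b) / i`!%:R.
Proof.
move=> Bb; rewrite coef_poly; case: ltnP => // Ni.
have h : iter (N b) delta b = 0.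
  exact: (@epsilon_spec nat (inhabits 0%N) (fun m => iter m delta b = 0) (nilp Bb)).
by rewrite -(subnK Ni) iterD h iter0 rmorph0 mul0r.
Qed.

Lemma coef0_exp_poly b : B b -> (E b)`_0 = psi b.
Proof. by move=> Bb; rewrite coef_exp_poly //= fact0 divr1. Qed.

Lemma deriv_exp_poly b : B b -> (E b)^`() = E (delta b).
Proof.
move=> Bb; have Bdb := Bd Bb.
apply/polyP=> i; rewrite coef_deriv !coef_exp_poly //.
rewrite -iterSr factS natrM -[_ *+ i.+1]mulr_natl; field.
by rewrite fact_neq0 addrC natr1 char0.
Qed.

Lemma exp_polyL c a b : B a -> B b -> E (c *: a + b) = iL c *: E a + E b.
Proof.
move=> Baa Bbb; apply/polyP=> i; rewrite coefD coefZ !coef_exp_poly ?iterL //.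
  by rewrite rmorphD -mul_mpolyC rmorphM psiC; ring.
by apply: BD => //; apply: BZ.
Qed.

Lemma exp_polyD a b : B a -> B b -> E (a + b) = E a + E b.
Proof. by move=> ? ?; have := @exp_polyL 1 a b; rewrite rmorph1 !scale1r; apply. Qed.

Lemma exp_poly0 : E 0 = 0.
Proof.
by apply/polyP=> i; rewrite coef_exp_poly // iter0 rmorph0 mul0r coef0.
Qed.

Lemma exp_polyZ c a : B a -> E (c *: a) = iL c *: E a.
Proof. by move=> ?; have := @exp_polyL c a 0; rewrite exp_poly0 !addr0; apply. Qed.

Lemma exp_polyN a : B a -> E (- a) = - E a.
Proof. by move=> ?; rewrite -scaleN1r exp_polyZ // rmorphN rmorph1 scaleN1r. Qed.

Lemma exp_polyC c : E c%:MP = (iL c)%:P.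
Proof.
apply: deriv_inj0 => //; first by rewrite deriv_exp_poly // deltaC exp_poly0 derivC.
by rewrite coef0_exp_poly // coefC psiC.
Qed.

(** Induction on both nilpotency orders, in the shape produced by differentiating a bilinear
    expression in [E a] and [E b]. *)
Lemma nilp_ind2 (Q : A -> A -> Prop) :
    (forall b, B b -> Q 0 b) -> (forall a, B a -> Q a 0) ->
    (forall a b, B a -> B b -> Q (delta a) b -> Q a (delta b) -> Q a b) ->
  forall a b, B a -> B b -> Q a b.
Proof.
move=> Q0 Q0' QS a b Baa Bbb.
have [p ha] := nilp Baa; have [q hb] := nilp Bbb.
elim: p a Baa ha b q Bbb hb => [|p IHp] a Baa ha b q Bbb hb.
  by rewrite [a]ha; apply: Q0.
elim: q b Bbb hb => [|q IHq] b Bbb hb; first by rewrite [b]hb; apply: Q0'.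
apply: QS => //; last by apply: IHq; [apply: Bd | rewrite -iterSr].
apply: (IHp _ _ _ _ q.+1) => //; [exact: Bd | by rewrite -iterSr].
Qed.

Lemma exp_polyM a b : B a -> B b -> E (a * b) = E a * E b.
Proof.
move: a b; apply: nilp_ind2 => [b Bb|a Baa|a b Baa Bbb IH1 IH2].
- by rewrite mul0r exp_poly0 mul0r.
- by rewrite mulr0 exp_poly0 mulr0.
apply: deriv_inj0 => //; last first.
  by rewrite coefM big_ord1 !coef0_exp_poly ?rmorphM //; apply: BM.
have Bab := BM Baa Bbb; have B1 := BM (Bd Baa) Bbb; have B2 := BM Baa (Bd Bbb).
by rewrite derivM !deriv_exp_poly // deltaM // exp_polyD // IH1 IH2.
Qed.

Lemma alpha_iter_delta b i : B b ->
  alpha (iter i delta b) = iter i delta (alpha b) + (s *+ i) *: iter i delta b.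
Proof.
move=> Bb; elim: i => [|i IH] /=; first by rewrite mulr0n scale0r addr0.
have Bi := Biter i Bb; have Bai := Biter i (Ba Bb); have Bab := Ba Bi.
have Bsi := BZ s Bi; have Bsi' := BZ (s *+ i) Bi.
rewrite alpha_delta // deltaD // IH deltaD // !deltaZ //.
by rewrite -addrA -scalerDl mulrSr.
Qed.

(** The ['X] term measures the failure of [delta] to be a Poisson derivation. On differentiating,
    that failure cancels against the term where ['X] itself is differentiated, and the two terms in
    [s] coming from [alpha delta = delta (alpha + s)] cancel each other. *)
Lemma exp_poly_br a b : B a -> B b ->
  poly_br brL (E a) (E b) = E (brA a b)
    + 'X * (E (delta a) * E (alpha b) - E (alpha a) * E (delta b)).
Proof.
have alpha0 : alpha 0 = 0 := derivation_on0 BC dalpha.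
have brA_r := @br_der k A (@mpolyC n k) brA pbrA.
have brA_l := @br_derl k A (@mpolyC n k) brA pbrA.
move: a b; apply: nilp_ind2 => [b Bb|a Baa|a b Baa Bbb IH1 IH2].
- by rewrite exp_poly0 poly_br0l (der0 (brA_l b)) delta0 alpha0
    !exp_poly0 !mul0r subr0 mulr0 addr0.
- by rewrite exp_poly0 poly_br0r (der0 (brA_r a)) delta0 alpha0
    !exp_poly0 !mulr0 subr0 mulr0 addr0.
have Bda := Bd Baa; have Bdb := Bd Bbb; have Bal := Ba Baa; have Bbl := Ba Bbb.
have Ealpha_delta u : B u -> E (alpha (delta u)) = E (delta (alpha u)) + iL s *: E (delta u).
  move=> Bu; have Bau := Ba Bu; have Bsu := BZ s Bu; have Bdu := Bd Bu.
  have Bsdu := BZ s Bdu; have Bdau := Bd Bau.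
  by rewrite alpha_delta // deltaD // deltaZ // exp_polyD // exp_polyZ.
have E_delta_br : E (delta (brA a b)) = E (brA (delta a) b) + E (brA a (delta b))
    + E (alpha a) * E (delta b) - E (delta a) * E (alpha b).
  have B1 := Bbr Bda Bbb; have B2 := Bbr Baa Bdb; have B3 := BM Bal Bdb.
  have B4 := BM Bda Bbl; have B5 := BN B4; have B6 := BD B1 B2; have B7 := BD B6 B3.
  rewrite delta_br // (exp_polyD B7 B5) (exp_polyD B6 B3) (exp_polyD B1 B2).
  by rewrite exp_polyN // !exp_polyM.
apply: deriv_inj0 => //; last first.
  (* The successor in the bound lets [big_ord_recl] split off index 0 even for zero polynomials. *)
  rewrite coefD coefXM /= addr0 (@poly_brE _ _ br_r br_l (size (E a) + size (E b)).+1).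
  - rewrite coef_sum big_ord_recl coef_sum big_ord_recl /= coefZ coefXn eqxx mulr1.
    rewrite !coef0_exp_poly ?psi_br //; last exact: Bbr.
    rewrite big1 => [|j _]; last by rewrite coefZ coefXn mulr0.
    rewrite big1 ?addr0 // => i _; rewrite coef_sum big1 // => j _.
    by rewrite coefZ coefXn mulr0.
  - by rewrite leqW // leq_addr.
  - by rewrite leqW // leq_addl.
rewrite (deriv_poly_br br_r br_l) !deriv_exp_poly // IH1 IH2 derivD derivM derivX.
rewrite derivB !derivM.
rewrite !deriv_exp_poly ?E_delta_br ?Ealpha_delta //; last exact: Bbr.
rewrite -!mul_polyC; ring.
Qed.

Let tau : L := - (iL s * x)^-1.

(** The bracket of [tau] with [psi u] is [- tau (psi (alpha u) - s tau psi (delta u))]. On the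
    coefficients of [E b] the multiples [i s] from [alpha_iter_delta] assemble to [s 'X E'], which
    cancels the [delta] term at ['X = tau]. This is the reason for the choice of [tau]. *)
Lemma br_tau_horner b : B b ->
  (coef_br brL tau (E b)).[tau] = - tau * (E (alpha b)).[tau].
Proof.
move=> Bb; have Bdb := Bd Bb; have Bab := Ba Bb.
have is0 : iL s != 0 by rewrite fmorph_eq0.
have br_tau u : B u ->
    brL tau (psi u) = - tau * (psi (alpha u) - iL s * tau * psi (delta u)).
  move=> Bu; rewrite (derN (br_l _)) (derV (br_l _)) (derM (br_l _)) br_x //.
  rewrite [brL (iL s) _](brC pbrL) (br_const pbrL) oppr0 mul0r add0r /tau.
  by field; rewrite x_neq0 is0.
have -> : coef_br brL tau (E b) = - tau *: (E (alpha b)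
    + iL s *: ('X * (E b)^`()) - (iL s * tau) *: (E b)^`()).
  apply/polyP => i; rewrite (coef_coef_br br_r) coefZ !coefD coefN !coefZ coefXM.
  have -> : (if i == 0%N then 0 else (E b)^`()`_i.-1) = (E b)`_i *+ i.
    by case: i => [|i] //=; rewrite ?mulr0n // coef_deriv.
  rewrite deriv_exp_poly // !coef_exp_poly //.
  have -> : brL tau (psi (iter i delta b) / i`!%:R) =
            brL tau (psi (iter i delta b)) / i`!%:R.
    rewrite (derM (br_r tau)) -(rmorph_nat iL) -fmorphV (br_const pbrL).
    by rewrite mulr0 addr0.
  rewrite br_tau ?alpha_iter_delta //; last exact: Biter.
  rewrite rmorphD -mul_mpolyC rmorphM psiC rmorphMn -iterSr /=.
  by field; rewrite fact_neq0.
by rewrite hornerZ !hornerD hornerN !hornerZ hornerM hornerX; ring.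
Qed.

Definition deleting_map b : L := (E b).[tau].
Local Notation theta := deleting_map.

Lemma deleting_mapC c : theta c%:MP = iL c.
Proof. by rewrite /theta exp_polyC hornerC. Qed.

Lemma deleting_mapD a b : B a -> B b -> theta (a + b) = theta a + theta b.
Proof. by move=> Baa Bbb; rewrite /theta exp_polyD // hornerD. Qed.

Lemma deleting_mapM a b : B a -> B b -> theta (a * b) = theta a * theta b.
Proof. by move=> Baa Bbb; rewrite /theta exp_polyM // hornerM. Qed.

(** The chain-rule terms of [br_horner], computed by [br_tau_horner], cancel the ['X] correction of
    [exp_poly_br] evaluated at [tau]. *)
Lemma deleting_map_br a b : B a -> B b ->
  theta (brA a b) = brL (theta a) (theta b).
Proof.
move=> Baa Bbb; rewrite /theta (br_horner br_r br_l); last exact: brC pbrL.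
  rewrite exp_poly_br // !br_tau_horner // !deriv_exp_poly //.
  by rewrite hornerD hornerM hornerX hornerD hornerN !hornerM; ring.
apply: (br_self pbrL); apply: mulfI; exact: char0.
Qed.

(** Since [x] is a scalar multiple of the inverse of [tau], its bracket follows from that of
    [tau]. *)
Lemma deleting_map_br_x b : B b -> brL x (theta b) = theta (alpha b) * x.
Proof.
move=> Bb.
have is0 : iL s != 0 by rewrite fmorph_eq0.
have btt : brL tau tau = 0 by apply: (br_self pbrL); apply: mulfI; exact: char0.
have h : brL tau (theta b) = - tau * theta (alpha b).
  by rewrite /theta (br_hornerr br_r) // br_tau_horner.
have := h; rewrite (derN (br_l _)) (derV (br_l _)) (derM (br_l _)).
rewrite [brL (iL s) _](brC pbrL) (br_const pbrL) oppr0 mul0r add0r /tau.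
move=> {}h; have -> : brL x (theta b) =
    - (- (iL s * brL x (theta b)) / (iL s * x) ^+ 2) * (iL s * x ^+ 2).
  by field; rewrite x_neq0 is0.
by rewrite h; field; rewrite x_neq0 is0.
Qed.

(** [theta b] is [psi b] plus multiples of [psi (delta^r b)] with [r > 0], whose nilpotency order is
    smaller; induction on this order recovers [psi b]. *)
Lemma deleting_map_gen (F : L -> Prop) : subfield_pred F ->
  (forall c, F (iL c)) -> F x -> (forall b, B b -> F (theta b)) ->
  forall b, B b -> F (psi b).
Proof.
move=> sF Fk Fx Ft b Bb; have [m hm] := nilp Bb.
have [_ FB FM FV] := sF.
have Ftau : F tau.
  by apply: subfield_predN => //; apply: FV; apply: FM.
elim: m {-2}m (leqnn m) b Bb hm => [|m IH] m' hm' b Bb hm.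
  by move: hm' hm; rewrite leqn0 => /eqP -> /= ->; rewrite rmorph0; apply: subfield_pred0.
pose S := \sum_(i < size (E b)) (E b)`_i.+1 * tau ^+ i.+1.
have -> : psi b = theta b - S.
  (* One coefficient more than the size, so that index 0 can always be split off. *)
  rewrite /theta (horner_coef_wide _ (leqW (leqnn _))) big_ord_recl /= expr0.
  by rewrite mulr1 coef0_exp_poly // addrK.
apply: (FB); first exact: Ft.
apply: subfield_pred_sum => // i _; apply: (FM); last exact: subfield_predX.
rewrite coef_exp_poly // -(rmorph_nat iL) -fmorphV; apply: (FM) => //.
apply: (IH (m' - i.+1)%N); last 1 first.
- case: (leqP i.+1 m') => him; first by rewrite -iterD subnK.
  have -> : iter i.+1 delta b = 0 by rewrite -(subnK (ltnW him)) iterD hm iter0.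
  exact: iter0.
- by rewrite leq_subLR addSn (leq_trans hm') // ltnS leq_addl.
- exact: Biter.
Qed.

End DeletingDerivation.

(** * Deleting all derivations in turn *)

Section IteratedPoisson.
Variables (k : fieldType) (n : nat).
Local Notation A := {mpoly k[n]}.
Variables (br : A -> A -> A) (alpha delta : 'I_n -> A -> A).
Variables (s : 'I_n -> k) (lambda : 'M[k]_n).
Hypothesis char0 : forall m, m.+1%:R != 0 :> k.
Hypothesis itA : iterated_poisson_poly br alpha delta.
Hypothesis nilp : forall (i : 'I_n) b, lower_vars i b ->
  exists N : nat, iter N (delta i) b = 0.
Hypothesis s_neq0 : forall i, s i != 0.
Hypothesis alpha_delta : forall (i : 'I_n) b, lower_vars i b ->
  alpha i (delta i b) = delta i (alpha i b + s i *: b).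
Hypothesis lambda_anti : lambda^T = - lambda.
Hypothesis alphaX : forall i j : 'I_n, (j < i)%N ->
  alpha i 'X_j = lambda i j *: 'X_j.

Let pbr : poisson_bracket (@mpolyC n k) br. Proof. by case: itA. Qed.
Let brr := br_der pbr.
Let brl := br_derl pbr.

Let dalpha (i : 'I_n) : derivation_on (@lower_vars k n i) (alpha i).
Proof. by case: itA => _ /(_ i) [[]]. Qed.
Let ddelta (i : 'I_n) : derivation_on (@lower_vars k n i) (delta i).
Proof. by case: itA => _ /(_ i) []. Qed.
Let brX (i : 'I_n) b : lower_vars i b -> br 'X_i b = alpha i b * 'X_i + delta i b.
Proof. by case: itA => _ /(_ i) [_ _ _]; apply. Qed.

Let lowC := @lower_varsC k n.

(** The derivation laws reduce this to two variables; [alpha] and [delta] of the larger one preserve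
    the polynomials in the variables below it. *)
Lemma lower_vars_br (t : nat) a b :
  lower_vars t a -> lower_vars t b -> lower_vars t (br a b).
Proof.
have low0 : lower_vars t (0 : A) by rewrite -mpolyC0; apply: lowC.
have lowXX (j l : 'I_n) : (l < j)%N -> (j < t)%N -> lower_vars t (br 'X_j 'X_l).
  move=> lj jt; have lX := @lower_varsX k n _ _ lj; rewrite brX //.
  have [h _ _] := dalpha j; have [h' _ _] := ddelta j.
  apply: lower_varsD; last exact: lower_varsW (ltnW jt) (h' _ lX).
  apply: lower_varsM; [exact: lower_varsW (ltnW jt) (h _ lX) | exact: lower_varsX].
have two : GRing.lreg (2%:R : A).
  apply: mulfI; rewrite -mpolyC_nat mpolyC_eq0; exact: char0.
move=> la; move: b; apply: lower_vars_ind => [c|j jt|p q lp lq hp hq|p q lp lq hp hq].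
- by rewrite (br_const pbr).
- move: a la; apply: lower_vars_ind => [c|l lt|p q lp lq hp hq|p q lp lq hp hq].
  + by rewrite (brC pbr) (br_const pbr) oppr0.
  + case: (ltngtP l j) => [lj|jl|/val_inj ->].
    * by rewrite (brC pbr); apply: lower_varsN; apply: lowXX.
    * exact: lowXX.
    * by rewrite (br_self pbr).
  + by rewrite (derD (brl _)); apply: lower_varsD.
  + have lX := @lower_varsX k n _ _ jt.
    by rewrite (derM (brl _)); apply: lower_varsD; apply: lower_varsM.
- by rewrite (derD (brr _)); apply: lower_varsD.
- by rewrite (derM (brr _)); apply: lower_varsD; apply: lower_varsM.
Qed.

Section Weights.
Variables (i l : 'I_n).
Hypothesis il : (i < l)%N.

Let lowil (b : A) : lower_vars i b -> lower_vars l b.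
Proof. exact: lower_varsW (ltnW il). Qed.

Lemma alpha_lower b : lower_vars i b -> lower_vars i (alpha l b).
Proof.
move: b; apply: lower_vars_ind => [c|j ji|p q lp lq hp hq|p q lp lq hp hq].
- by rewrite (derivation_onC (@lowC l) (dalpha l)) -mpolyC0; apply: lowC.
- rewrite alphaX; last exact: ltn_trans ji il.
  by apply: lower_varsZ; apply: lower_varsX.
- by rewrite (derivation_onD (dalpha l)); [apply: lower_varsD|apply: lowil..].
- rewrite (derivation_onM (dalpha l)); [|exact: lowil..].
  by apply: lower_varsD; apply: lower_varsM.
Qed.

(** Derivations that are diagonal on the same variables commute. *)
Lemma alpha_comm b : lower_vars i b -> alpha l (alpha i b) = alpha i (alpha l b).
Proof.
have li a : lower_vars i a -> lower_vars i (alpha i a) by case: (dalpha i) => h _ _; apply: h.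
move: b; apply: lower_vars_ind => [c|j ji|p q lp lq hp hq|p q lp lq hp hq].
- rewrite (derivation_onC (@lowC l) (dalpha l)) (derivation_onC (@lowC i) (dalpha i)).
  by rewrite (derivation_on0 (@lowC l) (dalpha l)) (derivation_on0 (@lowC i) (dalpha i)).
- have jl := ltn_trans ji il; rewrite !alphaX //.
  rewrite (derivation_onZ (@lowC l) (dalpha l)); last exact: lower_varsX.
  rewrite (derivation_onZ (@lowC i) (dalpha i)); last exact: lower_varsX.
  by rewrite !alphaX // !scalerA mulrC.
- have := li _ lp; have := li _ lq; have := alpha_lower lp; have := alpha_lower lq.
  move=> h1 h2 h3 h4.
  rewrite (derivation_onD (dalpha i)) // (derivation_onD (dalpha l)); try exact: lowil.
  rewrite (derivation_onD (dalpha l)); try exact: lowil.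
  by rewrite (derivation_onD (dalpha i)) // hp hq.
- have := li _ lp; have := li _ lq; have := alpha_lower lp; have := alpha_lower lq.
  move=> h1 h2 h3 h4.
  have m1 := lower_varsM h4 lq; have m2 := lower_varsM lp h3.
  have m3 := lower_varsM h2 lq; have m4 := lower_varsM lp h1.
  rewrite (derivation_onM (dalpha i)) // (derivation_onD (dalpha l)); try exact: lowil.
  rewrite !(derivation_onM (dalpha l)); try exact: lowil.
  rewrite (derivation_onD (dalpha i)) // !(derivation_onM (dalpha i)) // hp hq.
  ring.
Qed.

(** Apply the Poisson derivation [alpha l] to [{x_i, b} = alpha_i(b) x_i + delta_i(b)] and cancel
    the terms in [alpha_i]: thus [delta i] has weight [lambda l i] under [alpha l]. *)
Lemma alpha_delta_comm b : lower_vars i b ->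
  alpha l (delta i b) = delta i (alpha l b) + lambda l i *: delta i b.
Proof.
move=> lb.
have h1 : lower_vars i (alpha i b) by case: (dalpha i) => h _ _; apply: h.
have h2 : lower_vars i (delta i b) by case: (ddelta i) => h _ _; apply: h.
have lX : lower_vars l ('X_i : A) by apply: lower_varsX.
have E : br 'X_i b = alpha i b * 'X_i + delta i b by apply: brX.
have [_ /(_ 'X_i b lX (lowil lb))] : poisson_derivation_on br (@lower_vars k n l) (alpha l).
  by case: itA => _ /(_ l) [].
have m1 : lower_vars l (alpha i b * 'X_i) by apply: lower_varsM => //; apply: lowil.
rewrite {1}E (derivation_onD (dalpha l)) //; last exact: lowil.
rewrite (derivation_onM (dalpha l)) //; last exact: lowil.
rewrite alphaX // -mul_mpolyC (derM (brl _)) [br (_%:MP) _](brC pbr) (br_const pbr).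
rewrite oppr0 mul0r add0r E (brX (alpha_lower lb)) (alpha_comm lb) -mul_mpolyC => h.
have -> : alpha l (delta i b) = alpha i (alpha l b) * 'X_i +
  alpha i b * ((lambda l i)%:MP_[n] * 'X_i) + alpha l (delta i b) -
  (alpha i (alpha l b) * 'X_i + alpha i b * ((lambda l i)%:MP_[n] * 'X_i)) by ring.
by rewrite h; ring.
Qed.

Lemma alpha_iter_deltaX (j : 'I_n) m : (j < i)%N ->
  alpha l (iter m (delta i) 'X_j) =
  (lambda l j + lambda l i *+ m) *: iter m (delta i) 'X_j.
Proof.
move=> ji; have lX := @lower_varsX k n _ _ ji.
have low m' : lower_vars i (iter m' (delta i) 'X_j).
  by elim: m' => //= m'; case: (ddelta i) => h _ _; apply: h.
elim: m => [|m IH] /=; first by rewrite mulr0n addr0 alphaX // (ltn_trans ji).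
rewrite alpha_delta_comm // IH (derivation_onZ (@lowC i) (ddelta i)) //.
by rewrite -scalerDl mulrSr addrA.
Qed.

End Weights.

Variables (L : fieldType) (iL : {rmorphism k -> L}) (brL : L -> L -> L).
Hypothesis pbrL : poisson_bracket iL brL.
Let brLr := br_der pbrL.
Let brLl := br_derl pbrL.
Let charL m : m.+1%:R != 0 :> L.
Proof. by rewrite -(rmorph_nat iL) fmorph_eq0. Qed.

(** The state once the indices from [t] on are processed: brackets involving them are monomial, and
    [mmap iL u] is required to respect the bracket only on the variables below [t]. *)
Definition deleted_from (t : nat) (u : 'I_n -> L) : Prop :=
  [/\ generates iL u,
      (forall i j : 'I_n, (t <= i)%N -> (j < i)%N ->
         brL (u i) (u j) = iL (lambda i j) * u i * u j) &
      (forall a b, lower_vars t a -> lower_vars t b ->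
         mmap iL u (br a b) = brL (mmap iL u a) (mmap iL u b))].

Lemma deleting_step (i : 'I_n) u :
  deleted_from i.+1 u -> exists u', deleted_from i u'.
Proof.
move=> [gen rel pois].
(* If [u i] vanishes, so do all brackets with it, and [u] itself serves. *)
have [ui0|ui0] := eqVneq (u i) 0.
  exists u; split=> // [i' j|a b la lb].
    rewrite leq_eqVlt => /orP[/eqP/val_inj <- _|ti ji]; last exact: rel.
    by rewrite ui0 mulr0 mul0r (der0 (brLl _)).
  by apply: pois; apply: lower_varsW (leqnSn i) _.
pose psi : {rmorphism A -> L} := mmap iL u.
pose B := @lower_vars k n i.
have psiC c : psi c%:MP = iL c by rewrite /psi /= mmapC.
have psiX j : psi 'X_j = u j by rewrite /psi /= mmapX mmap1U.
have lowS b : B b -> lower_vars i.+1 b by apply: lower_varsW.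
have psi_br a b : B a -> B b -> psi (br a b) = brL (psi a) (psi b).
  by move=> la lb; apply: pois; apply: lowS.
have delta_br a b : B a -> B b -> delta i (br a b) = br (delta i a) b +
    br a (delta i b) + alpha i a * delta i b - delta i a * alpha i b.
  by case: itA => _ /(_ i) [_ _ h _]; apply: h.
have br_x b : B b -> brL (u i) (psi b) = psi (alpha i b) * u i + psi (delta i b).
  move=> lb; rewrite -(psiX i) -(pois 'X_i b); [|exact: lower_varsX|exact: lowS].
  by rewrite -[mmap _ _ _]/(psi _) brX // rmorphD rmorphM.
have BC := @lowC i; have BD := @lower_varsD k n i; have BM := @lower_varsM k n i.
have Bbr := @lower_vars_br i.
have nil := @nilp i; have dd := ddelta i; have da := dalpha i.
have ad := @alpha_delta i; have si := s_neq0 i.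
pose th := deleting_map iL (delta i) (s i) psi (u i).
have thC c : th c%:MP = iL c by apply: (deleting_mapC (B := B)) => //.
have thD a b : B a -> B b -> th (a + b) = th a + th b.
  by apply: (deleting_mapD (B := B)).
have thM a b : B a -> B b -> th (a * b) = th a * th b.
  by apply: (deleting_mapM (B := B)).
have th_br a b : B a -> B b -> th (br a b) = brL (th a) (th b).
  by apply: (deleting_map_br (B := B) (alpha := alpha i)) => //.
have th_x b : B b -> brL (u i) (th b) = th (alpha i b) * u i.
  by apply: (deleting_map_br_x (B := B)) => //.
pose u' (j : 'I_n) := if (j < i)%N then th 'X_j else u j.
have th_mmap b : B b -> mmap iL u' b = th b.
  move: b; apply: lower_vars_ind => [c|j ji|p q lp lq hp hq|p q lp lq hp hq].
  - by rewrite mmapC thC.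
  - by rewrite mmapX mmap1U /u' ji.
  - by rewrite mmapD hp hq thD.
  - by rewrite rmorphM /= hp hq thM.
exists u'; split.
- move=> F sF Fk Fu'.
  have Fx : F (u i) by have := Fu' i; rewrite /u' ltnn.
  have Fth b : B b -> F (th b).
    by move=> lb; rewrite -th_mmap //; apply: subfield_pred_mmap.
  apply: gen => // j; case: (ltnP j i) => ji; last first.
    by have := Fu' j; rewrite /u' ltnNge ji.
  rewrite -psiX; apply: (deleting_map_gen (B := B) (iL := iL) (delta := delta i)
    (s := s i) (x := u i)) => //; exact: lower_varsX.
- move=> l j; rewrite leq_eqVlt => /orP[/eqP/val_inj <- ji|il jl].
    have lX := @lower_varsX k n _ _ ji; rewrite /u' ltnn ji th_x // alphaX //.
    by rewrite -mul_mpolyC (thM _ _ (BC _) lX) thC; ring.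
  rewrite /u' [(l < i)%N]ltnNge (ltnW il) /=; case: (ltnP j i) => ji; last exact: rel.
  (* As [u l] was processed earlier, bracketing with it acts on [psi b] through the diagonal
     derivation [alpha l]. *)
  have br_l b : lower_vars i.+1 b -> brL (u l) (psi b) = psi (alpha l b) * u l.
    move: b; apply: lower_vars_ind => [c|j' ji'|p q lp lq hp hq|p q lp lq hp hq].
    + rewrite psiC (br_const pbrL) (derivation_onC (@lowC l) (dalpha l)).
      by rewrite rmorph0 mul0r.
    + have jl' := leq_trans ji' il.
      rewrite psiX rel // alphaX // -mul_mpolyC rmorphM psiC psiX; ring.
    + rewrite rmorphD (derD (brLr _)) hp hq (derivation_onD (dalpha l)).
      * by rewrite rmorphD; ring.
      * exact: lower_varsW lp.
      * exact: lower_varsW lq.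
    + rewrite rmorphM (derM (brLr _)) hp hq (derivation_onM (dalpha l)).
      * by rewrite rmorphD !rmorphM; ring.
      * exact: lower_varsW lp.
      * exact: lower_varsW lq.
  have lX := @lower_varsX k n _ _ ji.
  (* Under the bracket with [u l], the image of [delta_i^m(x_j)] has weight
     [lambda l j + m lambda l i] and the [m]-th power of [(s_i u_i)^-1] has weight [- m lambda l i],
     both times [u l]. Hence every term of [th 'X_j] has the weight of [lambda l j]. *)
  have eig0 : brL (u l) (u i) = iL (lambda l i) * u l * u i by apply: rel.
  have eigs : brL (u l) (iL (s i)) = 0 * iL (s i) by rewrite (br_const pbrL) mul0r.
  have eigt := der_eigenV (brLr _) (der_eigenM (brLr _) eigs eig0).
  rewrite add0r in eigt.
  rewrite /th /deleting_map horner_coef (der_sum (brLr _)) mulr_sumr.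
  apply: eq_bigr => m _; rewrite (coef_exp_poly (B := B)) // exprNn.
  have eigc : brL (u l) (psi (iter m (delta i) 'X_j) / m`!%:R * (-1) ^+ m) =
      iL (lambda l j + lambda l i *+ m) * u l *
      (psi (iter m (delta i) 'X_j) / m`!%:R * (-1) ^+ m).
    rewrite -(rmorph_nat iL) -[-1](rmorphN1 iL) -rmorphXn /= -fmorphV -mulrA -rmorphM.
    rewrite (derM (brLr _)) (br_const pbrL) mulr0 addr0.
    have low m' : lower_vars i (iter m' (delta i) 'X_j).
      by elim: m' => //= m'; case: (ddelta i) => h _ _; apply: h.
    rewrite br_l; last exact: lowS (low m).
    rewrite alpha_iter_deltaX // -mul_mpolyC (rmorphM psi) psiC; ring.
  rewrite mulrA (der_eigenM (brLr _) eigc (der_eigenX (brLr _) m eigt)).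
  rewrite rmorphD rmorphMn /=; ring.
- move=> a b la lb; rewrite !th_mmap //; [exact: th_br | exact: Bbr].
Qed.

(** Stated for any field with a Poisson map from [A] whose image generates it, so that it covers
    [Fract A] and [Fract A/P] alike. *)
Lemma quasi_commuting_generators (phi : {rmorphism A -> L}) :
    (forall c : k, phi c%:MP = iL c) ->
    (forall z : L, exists a b, phi b != 0 /\ z = phi a / phi b) ->
    (forall a b, phi (br a b) = brL (phi a) (phi b)) ->
  exists w : 'I_n -> L, generates iL w /\
    forall i j, brL (w i) (w j) = iL (lambda i j) * w i * w j.
Proof.
move=> phiC phi_gen phi_br; pose u j := phi 'X_j.
have phiE p : mmap iL u p = phi p.
  move: p (@lower_varsT k n p); apply: lower_vars_ind => [c|j _|p q _ _ hp hq|p q _ _ hp hq].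
  - by rewrite mmapC phiC.
  - by rewrite mmapX mmap1U.
  - by rewrite mmapD hp hq rmorphD.
  - by rewrite !rmorphM /= hp hq.
have base : deleted_from n u.
  split=> [F sF Fk Fu z|i j|a b _ _]; last by rewrite !phiE.
  - have Fphi a : F (phi a) by rewrite -phiE; apply: subfield_pred_mmap.
    have [a [b [_ ->]]] := phi_gen z; case: sF => _ _ FM FV.
    by apply: FM => //; apply: FV.
  - by rewrite leqNgt ltn_ord.
(* After [t] steps the last [t] indices are processed; the next one is [n - t.+1]. *)
have all t : (t <= n)%N -> exists w, deleted_from (n - t) w.
  elim: t => [_|t IH tn]; first by exists u; rewrite subn0.
  have [w hw] := IH (ltnW tn).
  have lt : (n - t.+1 < n)%N by rewrite ltn_subrL /= (leq_ltn_trans _ tn).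
  apply: (@deleting_step (Ordinal lt) w); rewrite /= subnSK //.
have [w] := all n (leqnn n); rewrite subnn => -[gen rel _].
exists w; split=> // i j.
have la : lambda i j = - lambda j i.
  by have /matrixP/(_ j i) := lambda_anti; rewrite !mxE.
(* [deleted_from] covers [j < i] only. Antisymmetry gives the other order and, 2 being invertible,
   forces [lambda i i = 0]. *)
case: (ltngtP i j) => [ij|ji|/val_inj ij]; last 1 first.
- have l0 : lambda i i = 0.
    rewrite -ij in la; apply/eqP; move/eqP: la; rewrite -addr_eq0 -mulr2n -mulr_natl.
    by rewrite mulf_eq0 (negPf (char0 1)).
  by rewrite -ij l0 rmorph0 !mul0r (br_self pbrL) //; apply: mulfI; apply: charL.
- rewrite (brC pbrL) rel // la rmorphN; ring.
- exact: rel.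
Qed.

End IteratedPoisson.

Lemma subm_self (n : nat) (m : 'X_{1..n}) : (m - m = 0)%MM.
Proof. by apply/mnmP => i; rewrite mnmBE mnm0E subnn. Qed.

(** * Fraction fields: extending embeddings and derivations *)

Section QuotientRule.
Variables (L : fieldType) (p q p' q' dp dq dp' dq' : L).
Hypotheses (q0 : q != 0) (q0' : q' != 0).

Lemma quotient_ruleD :
  ((dp * q' + p * dq' + (dp' * q + p' * dq)) * (q * q')
   - (p * q' + p' * q) * (dq * q' + q * dq')) / (q * q') ^+ 2 =
  (dp * q - p * dq) / q ^+ 2 + (dp' * q' - p' * dq') / q' ^+ 2.
Proof. by field; rewrite q0 q0'. Qed.

Lemma quotient_ruleM :
  ((dp * p' + p * dp') * (q * q') - p * p' * (dq * q' + q * dq')) / (q * q') ^+ 2 =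
  (dp * q - p * dq) / q ^+ 2 * (p' / q') + p / q * ((dp' * q' - p' * dq') / q' ^+ 2).
Proof. by field; rewrite q0 q0'. Qed.

End QuotientRule.

Section FractionField.
Local Open Scope quotient_scope.
Variable R : idomainType.
Local Notation "x %:F" := (@FracField.tofrac R x).
Implicit Types x y : {fraction R}.

(** Taken from the representative picked by [repr], so what is defined through it has to be shown
    independent of that choice, as in [frac_liftE] and [frac_derE]. *)
Definition frac_num x : R := (frac (repr x)).1.
Definition frac_den x : R := (frac (repr x)).2.

Lemma frac_den_neq0 x : frac_den x != 0.
Proof. exact: denom_ratioP. Qed.

Lemma frac_numE x : (frac_num x)%:F = x * (frac_den x)%:F.
Proof.
apply/esym; rewrite -[x in x * _]reprK /frac_num /frac_den; move: (repr x) => r.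
rewrite !piE.
apply/eqmodP; rewrite /= FracField.equivfE /FracField.mulf.
have dr := denom_ratioP r.
by rewrite !numden_Ratio ?mulr1 ?oner_neq0 // mulrC.
Qed.

Lemma fracE x : x = (frac_num x)%:F / (frac_den x)%:F.
Proof. by rewrite frac_numE mulfK // tofrac_eq0 frac_den_neq0. Qed.

Section Lift.
Variables (L : fieldType) (h : {rmorphism R -> L}).
Hypothesis h_inj : forall a, h a = 0 -> a = 0.

Definition frac_lift x : L := h (frac_num x) / h (frac_den x).

Let h_neq0 a : a != 0 -> h a != 0.
Proof. by apply: contra_neq => /h_inj. Qed.

Lemma frac_liftE a b : b != 0 -> frac_lift (a%:F / b%:F) = h a / h b.
Proof.
move=> b0; set x := _ / _; have d0 := frac_den_neq0 x.
have b0' : b%:F != 0 by rewrite tofrac_eq0.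
have d0' : (frac_den x)%:F != 0 by rewrite tofrac_eq0.
have : frac_num x * b = a * frac_den x.
  apply/eqP; rewrite -tofrac_eq !tofracM -(divfK b0' a%:F) -/x.
  by rewrite frac_numE mulrAC.
move/(congr1 h); rewrite !rmorphM => e; apply/eqP.
by rewrite eqr_div ?h_neq0 // e.
Qed.

Lemma frac_lift_tofrac a : frac_lift a%:F = h a.
Proof.
by have := @frac_liftE a 1 (oner_neq0 _); rewrite tofrac1 rmorph1 !divr1.
Qed.

Lemma frac_liftD x y : frac_lift (x + y) = frac_lift x + frac_lift y.
Proof.
have x0 := frac_den_neq0 x; have y0 := frac_den_neq0 y.
have -> : x + y = (frac_num x * frac_den y + frac_num y * frac_den x)%:F
                  / (frac_den x * frac_den y)%:F.
  rewrite {1}[x]fracE {1}[y]fracE addf_div ?tofrac_eq0 //.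
  by rewrite tofracD !tofracM.
rewrite frac_liftE ?mulf_neq0 // rmorphD !rmorphM /frac_lift.
by rewrite addf_div ?h_neq0.
Qed.

Lemma frac_liftM x y : frac_lift (x * y) = frac_lift x * frac_lift y.
Proof.
have x0 := frac_den_neq0 x; have y0 := frac_den_neq0 y.
have -> : x * y = (frac_num x * frac_num y)%:F / (frac_den x * frac_den y)%:F.
  by rewrite {1}[x]fracE {1}[y]fracE mulf_div !tofracM.
by rewrite frac_liftE ?mulf_neq0 // !rmorphM /frac_lift mulf_div.
Qed.

Lemma frac_lift1 : frac_lift 1 = 1.
Proof. by rewrite -tofrac1 frac_lift_tofrac rmorph1. Qed.

Lemma frac_lift_eq0 x : frac_lift x = 0 -> x = 0.
Proof.
move/eqP; rewrite /frac_lift mulf_eq0 invr_eq0 (negPf (h_neq0 (frac_den_neq0 x))).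
by rewrite orbF => /eqP/h_inj n0; rewrite [x]fracE n0 tofrac0 mul0r.
Qed.

End Lift.

Section FracDer.
Variable d : R -> R.
Hypothesis dd : is_der d.

Definition frac_der x : {fraction R} :=
  ((d (frac_num x))%:F * (frac_den x)%:F - (frac_num x)%:F * (d (frac_den x))%:F)
  / (frac_den x)%:F ^+ 2.

(** The cross-multiplied equality of the two fractions and its image under [d] together give the
    claim. *)
Lemma frac_derE a b : b != 0 ->
  frac_der (a%:F / b%:F) = ((d a)%:F * b%:F - a%:F * (d b)%:F) / b%:F ^+ 2.
Proof.
move=> b0; set x := (X in frac_der X); have d0 := frac_den_neq0 x.
have b0' : b%:F != 0 by rewrite tofrac_eq0.
have d0' : (frac_den x)%:F != 0 by rewrite tofrac_eq0.
have e : frac_num x * b = a * frac_den x.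
  apply/eqP; rewrite -tofrac_eq !tofracM -(divfK b0' a%:F) -/x.
  by rewrite frac_numE mulrAC.
have := congr1 (fun u => (d u)%:F) e; have := congr1 (@FracField.tofrac R) e.
rewrite !(derM dd) !tofracD !tofracM /frac_der.
move: (frac_num x)%:F (frac_den x)%:F d0' (d (frac_num x))%:F (d (frac_den x))%:F.
move=> p q q0 dp dq e1 e2; apply/eqP; rewrite eqr_div ?expf_neq0 //; apply/eqP.
have -> : (dp * q - p * dq) * b%:F ^+ 2 =
   q * b%:F * (dp * b%:F + p * (d b)%:F) - (p * b%:F) * (dq * b%:F + q * (d b)%:F) by ring.
by rewrite e1 e2; ring.
Qed.

Lemma frac_der_tofrac a : frac_der a%:F = (d a)%:F.
Proof.
have := @frac_derE a 1 (oner_neq0 _); rewrite (der1 dd) tofrac1 tofrac0.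
by rewrite mulr0 subr0 expr1n !divr1 mulr1.
Qed.

Lemma frac_der_is_der : is_der frac_der.
Proof.
split=> x y; have x0 := frac_den_neq0 x; have y0 := frac_den_neq0 y.
- have x0' : (frac_den x)%:F != 0 by rewrite tofrac_eq0.
  have y0' : (frac_den y)%:F != 0 by rewrite tofrac_eq0.
  have -> : x + y = (frac_num x * frac_den y + frac_num y * frac_den x)%:F
                  / (frac_den x * frac_den y)%:F.
    rewrite {1}[x]fracE {1}[y]fracE addf_div //.
    by rewrite tofracD !tofracM.
  rewrite frac_derE ?mulf_neq0 // (derD dd) !(derM dd) !tofracD !tofracM.
  exact: quotient_ruleD.
- have x0' : (frac_den x)%:F != 0 by rewrite tofrac_eq0.
  have y0' : (frac_den y)%:F != 0 by rewrite tofrac_eq0.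
  have -> : x * y = (frac_num x * frac_num y)%:F / (frac_den x * frac_den y)%:F.
    by rewrite {1}[x]fracE {1}[y]fracE mulf_div !tofracM.
  rewrite frac_derE ?mulf_neq0 // !(derM dd) !tofracD !tofracM.
  rewrite (quotient_ruleM _ _ _ _ _ _ x0' y0').
  by rewrite -!fracE.
Qed.

End FracDer.

End FractionField.

(** Evaluation at [y] extends to [g] on the rational functions, injective by independence and
    surjective by generation. The bracket on [ratfun K m] is transported from [L] along the inverse
    of [g], so its existence needs no separate construction; it is [K]-linear because [j] has
    Poisson central image. *)
Lemma qtorus_iso (k K L : fieldType) (iL : {rmorphism k -> L})
    (iK : {rmorphism k -> K}) (j : {rmorphism K -> L}) (brL : L -> L -> L)
    (m : nat) (mu : 'M[k]_m) (y : 'I_m -> L) :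
    poisson_bracket iL brL ->
    (forall c, j (iK c) = iL c) ->
    (forall c z, brL (j c) z = 0) ->
    generates j y ->
    (forall p : {mpoly K[m]}, mmap j y p = 0 -> p = 0) ->
    (forall a b, brL (y a) (y b) = iL (mu a b) * y a * y b) ->
  exists (brT : ratfun K m -> ratfun K m -> ratfun K m) (f : L -> ratfun K m),
    qtorus_bracket (map_mx iK mu) brT /\
    poisson_iso iL (fun c : k => @ratfunC K m (iK c)) brL brT f.
Proof.
move=> pbrL jK cent gen indep rel.
pose h : {rmorphism {mpoly K[m]} -> L} := mmap j y.
have h_inj a : h a = 0 -> a = 0 by apply: indep.
pose g : ratfun K m -> L := frac_lift h.
have gD : forall a b, g (a + b) = g a + g b := frac_liftD h_inj.
have gM : forall a b, g (a * b) = g a * g b := frac_liftM h_inj.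
have g1 : g 1 = 1 := frac_lift1 h_inj.
have gC c : g (@ratfunC K m c) = j c.
  by rewrite /g frac_lift_tofrac // /h /= mmapC.
have gY i : g (@ratfunY K m i) = y i.
  by rewrite /g frac_lift_tofrac // /h /= mmapX mmap1U.
have g0 : g 0 = 0 by apply: (@addrI _ (g 0)); rewrite -gD !addr0.
have gN a : g (- a) = - g a by apply/eqP; rewrite -addr_eq0 -gD addNr g0.
have g_inj : injective g.
  move=> a b e; apply/eqP; rewrite -subr_eq0; apply/eqP/(frac_lift_eq0 h_inj).
  by rewrite -/(g _) gD gN e subrr.
have gV a : g a^-1 = (g a)^-1.
  have [->|a0] := eqVneq a 0; first by rewrite invr0 g0 invr0.
  have ga0 : g a != 0 by apply: contra_neq a0; rewrite -{1}g0 => /g_inj.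
  by apply: (mulfI ga0); rewrite -gM !divff.
have g_surj : forall z, exists x, g x = z.
  apply: gen => [|c|i].
  - split=> [|a b [x <-] [x' <-]|a b [x <-] [x' <-]|a [x <-]].
    + by exists 1.
    + by exists (x - x'); rewrite gD gN.
    + by exists (x * x').
    + by exists x^-1.
  - by exists (ratfunC m c).
  - by exists (ratfunY K i).
pose f z := sval (constructive_indefinite_description _ (g_surj z)).
have fK : cancel f g by move=> z; rewrite /f; case: constructive_indefinite_description.
have gK : cancel g f by move=> x; apply: g_inj; rewrite fK.
exists (fun a b => f (brL (g a) (g b))), f.
have fD a b : f (a + b) = f a + f b by apply: g_inj; rewrite gD !fK.
have fM a b : f (a * b) = f a * f b by apply: g_inj; rewrite gM !fK.
have f1 : f 1 = 1 by apply: g_inj; rewrite fK g1.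
have fC c : f (j c) = ratfunC m c by rewrite -gC gK.
split; split.
- split=> [c a b d|a b|a b c|a b c]; apply: g_inj.
  + rewrite !(gD, gM) !fK gC (derD (br_derl pbrL _)) (derM (br_derl pbrL _)) cent.
    by rewrite mul0r add0r.
  + by rewrite gN !fK (brC pbrL).
  + by rewrite !gD !fK g0; case: pbrL => _ _ + _; apply.
  + by rewrite gD !gM !fK (derM (br_der pbrL _)).
- by move=> a b; apply: g_inj; rewrite fK !gM gC !gY mxE jK rel.
- by exists g.
- by [].
- by move=> c; rewrite -fC jK.
- by move=> a b; rewrite !fK.
Qed.

(** * Algebraic independence of [n] generators *)

Section Independence.
Variables (k : fieldType) (n : nat).
Hypothesis char0 : forall m, m.+1%:R != 0 :> k.
Local Notation A := {mpoly k[n]}.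

Lemma mderiv_eq0 (p : A) : (forall i, mderiv i p = 0) -> p = (p@_0%MM)%:MP.
Proof.
move=> dp; apply/mpolyP => m; rewrite mcoeffC.
have [->|m0] := eqVneq m 0%MM; first by rewrite mulr1.
have [i mi] : exists i, m i != 0%N.
  apply/existsP; apply: contraNT m0; rewrite negb_exists => /forallP h.
  by apply/eqP/mnmP => i; rewrite mnm0E; apply/eqP; rewrite -[_ == _]negbK h.
rewrite mulr0; have := congr1 (mcoeff (m - U_(i))) (dp i).
rewrite mcoeff_deriv mcoeff0 submK ?lep1mP // -mulr_natl => /eqP.
by rewrite mulf_eq0 (negPf (char0 _)) /= => /eqP.
Qed.

Lemma msize_mderiv (p : A) i : (msize (mderiv i p) <= (msize p).-1)%N.
Proof.
rewrite msizeE; apply/bigmax_leqP_seq => m mp _.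
have : (m + U_(i))%MM \in msupp p.
  move: mp; rewrite !mcoeff_msupp mcoeff_deriv; apply: contra_neq => ->.
  by rewrite mul0rn.
by move/msize_mdeg_lt; rewrite mdegD mdeg1 addn1; case: (msize p).
Qed.

(** Applying [D i] to [p(w) = 0] gives the same relation for the partial derivative of [p], which is
    smaller. By induction all partial derivatives vanish, so [p] is constant, hence 0. *)
Lemma dual_der_indep (L : fieldType) (iL : {rmorphism k -> L})
    (w : 'I_n -> L) (D : 'I_n -> L -> L) :
    (forall i, is_der (D i)) -> (forall i c, D i (iL c) = 0) ->
    (forall i l, D i (w l) = (i == l)%:R) ->
  forall p : A, mmap iL w p = 0 -> p = 0.
Proof.
move=> dD DC Dw.
have Dp i p : D i (mmap iL w p) = mmap iL w (mderiv i p).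
  move: p (@lower_varsT k n p); apply: lower_vars_ind => [c|l _|p q _ _ hp hq|p q _ _ hp hq].
  - by rewrite mderivC mmapC DC mmap0.
  - rewrite mderivX mmapX mmap1U Dw mmapZ mmapX mnm1E eq_sym.
    case: eqP => [->|_]; last by rewrite !mulr0n rmorph0 mul0r.
    by rewrite subm_self !mulr1n rmorph1 mul1r mmap11.
  - by rewrite mderivD !mmapD (derD (dD i)) hp hq.
  - by rewrite mderivM mmapD !rmorphM /= (derM (dD i)) hp hq.
move=> p; have [N] := ubnP (msize p); elim: N p => // N IH p; rewrite ltnS => hN p0.
suff pE : p = (p@_0%MM)%:MP.
  move: p0; rewrite pE mmapC => /eqP; rewrite fmorph_eq0 => /eqP ->.
  by rewrite mpolyC0.
have [sp|sp] := leqP (msize p) 1; first exact: msize1_polyC.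
apply: mderiv_eq0 => i; apply: IH; last by rewrite -Dp p0 (der0 (dD i)).
rewrite (leq_ltn_trans (msize_mderiv p i)) //.
by rewrite (leq_trans _ hN) // prednK // ltnW.
Qed.

(* Since a derivation is determined by its values on generators, the Jacobian
   of a generating family of length [n] is invertible; its inverse provides
   derivations dual to the family. *)
Lemma generators_indep (iL : {rmorphism k -> ratfun k n}) (w : 'I_n -> ratfun k n) :
    (forall c, iL c = ratfunC n c) -> generates iL w ->
  forall p : A, mmap iL w p = 0 -> p = 0.
Proof.
move=> iLE gen.
pose L := ratfun k n.
have dm i : is_der (mderiv i : A -> A).
  by split=> a b; [rewrite mderivD | rewrite mderivM].
pose pd i : L -> L := frac_der (mderiv i).
have dpd i : is_der (pd i) := frac_der_is_der (dm i).
have pdC i c : pd i (iL c) = 0.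
  by rewrite iLE /pd /ratfunC (frac_der_tofrac (dm i)) mderivC tofrac0.
pose comb (c : 'rV[L]_n) z := \sum_i c 0 i * pd i z.
have dcomb c : is_der (comb c).
  split=> a b; rewrite /comb.
    by rewrite -big_split; apply: eq_bigr => i _; rewrite (derD (dpd i)) mulrDr.
  rewrite mulr_suml mulr_sumr -big_split; apply: eq_bigr => i _ /=.
  by rewrite (derM (dpd i)); ring.
have combC c d : comb c (iL d) = 0.
  by rewrite /comb big1 // => i _; rewrite pdC mulr0.
pose J : 'M[L]_n := \matrix_(i, l) pd i (w l).
have combJ c l : comb c (w l) = (c *m J) 0 l.
  by rewrite mxE; apply: eq_bigr => i _; rewrite mxE.
(* A left kernel vector [v] yields a derivation [comb v] that kills every [w l], hence everything;
   its value at the [i]-th variable is [v 0 i]. *)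
have Ju : J \in unitmx.
  rewrite -row_free_unit -kermx_eq0; apply/rowV0P => v /sub_kermxP vJ0.
  have comb0 : forall z, comb v z = 0.
    apply: gen (subfield_pred_ker (dcomb v)) (combC v) _ => l.
    by rewrite combJ vJ0 mxE.
  apply/rowP => i; rewrite mxE -(comb0 (ratfunY k i)) /comb (bigD1 i) //=.
  rewrite big1 => [|l li]; rewrite /pd /ratfunY (frac_der_tofrac (dm _)) mderivX mnm1E.
    by rewrite eqxx subm_self scale1r mpolyX0 tofrac1 mulr1 addr0.
  by rewrite eq_sym (negPf li) scale0r tofrac0 mulr0.
(* The rows of the inverse Jacobian give the derivations dual to [w]. *)
pose c i := row i (invmx J).
apply: (@dual_der_indep _ iL w (fun i => comb (c i))) => // i l.
by rewrite combJ -row_mul mulVmx // !mxE.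
Qed.

End Independence.

(* The proof [sF] is an argument so that the instances below can find it. *)
Definition subfield_mem (L : fieldType) (F : L -> Prop) (sF : subfield_pred F) :
  {pred L} := fun z => if excluded_middle_informative (F z) then true else false.

(** * Subfields as field types *)

Section Subfield.
Variables (L : fieldType) (F : L -> Prop) (sF : subfield_pred F).

Lemma subfield_memP z : reflect (F z) (z \in subfield_mem sF).
Proof.
by rewrite /subfield_mem unfold_in /=; case: excluded_middle_informative; constructor.
Qed.

Fact subfield_mem_divring_closed : divring_closed (subfield_mem sF).
Proof.
case: (sF) => F1 FB FM FV; split=> [|a b|a b]; first exact/subfield_memP.
  by move=> /subfield_memP Fa /subfield_memP Fb; apply/subfield_memP/FB.
by move=> /subfield_memP Fa /subfield_memP Fb; apply/subfield_memP/FM/FV.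
Qed.

HB.instance Definition _ :=
  GRing.isDivringClosed.Build L (subfield_mem sF) subfield_mem_divring_closed.

Record subfield := Subfield {subfield_val : L; _ : subfield_val \in subfield_mem sF}.

HB.instance Definition _ := [isSub for subfield_val].
HB.instance Definition _ := [Choice of subfield by <:].
HB.instance Definition _ := [SubChoice_isSubIntegralDomain of subfield by <:].
HB.instance Definition _ := [SubIntegralDomain_isSubField of subfield by <:].

Lemma subfield_val_zmod_morphism : zmod_morphism subfield_val.
Proof. by []. Qed.
Lemma subfield_val_monoid_morphism : monoid_morphism subfield_val.
Proof. by []. Qed.
HB.instance Definition _ :=
  GRing.isZmodMorphism.Build subfield L subfield_val subfield_val_zmod_morphism.
HB.instance Definition _ :=
  GRing.isMonoidMorphism.Build subfield L subfield_val subfield_val_monoid_morphism.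

Lemma subfield_valP (c : subfield) : F (subfield_val c).
Proof. by case: c => z Fz; apply/subfield_memP. Qed.

Definition subfield_in z (Fz : F z) : subfield := Subfield (introT (subfield_memP z) Fz).

Section Corestriction.
Variables (k : fieldType) (iL : {rmorphism k -> L}).
Hypothesis Fk : forall c, F (iL c).

Definition subfield_cores c : subfield := subfield_in (Fk c).

Fact subfield_cores_zmod_morphism : zmod_morphism subfield_cores.
Proof. by move=> a b; apply: val_inj; rewrite /= rmorphB. Qed.
Fact subfield_cores_monoid_morphism : monoid_morphism subfield_cores.
Proof.
by split=> [|a b]; apply: val_inj; rewrite /= ?rmorph1 ?rmorphM.
Qed.
HB.instance Definition _ :=
  GRing.isZmodMorphism.Build k subfield subfield_cores subfield_cores_zmod_morphism.
HB.instance Definition _ :=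
  GRing.isMonoidMorphism.Build k subfield subfield_cores subfield_cores_monoid_morphism.

End Corestriction.

End Subfield.

(* Dedekind's argument: monomials with distinct weights under a
   family of derivations cannot cancel. *)
Lemma weights_indep (K L : fieldType) (j : {rmorphism K -> L}) (m : nat)
    (y : 'I_m -> L) (I : Type) (D : I -> L -> L) (c : 'I_m -> I -> K) :
    (forall l, is_der (D l)) -> (forall l a, D l (j a) = 0) ->
    (forall i, y i != 0) -> (forall l i, D l (y i) = j (c i l) * y i) ->
    (forall a b : 'X_{1..m},
       (forall l, \sum_i c i l *+ a i = \sum_i c i l *+ b i) -> a = b) ->
  forall p : {mpoly K[m]}, mmap j y p = 0 -> p = 0.
Proof.
move=> dD Dj y0 Dy sep.
pose chi l (a : 'X_{1..m}) := \sum_i c i l *+ a i.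
have Dm l a : D l (mmap1 y a) = j (chi l a) * mmap1 y a.
  rewrite /mmap1 (@der_eigen_prod _ _ (dD l) _ _ (fun i => j (c i l) *+ a i)).
    by rewrite rmorph_sum; congr (_ * _); apply: eq_bigr => i _; rewrite rmorphMn.
  by move=> i; apply: der_eigenX.
move=> p; have [N] := ubnP (size (msupp p)); elim: N p => // N IH p.
rewrite ltnS => hN p0; apply/eqP; apply: contraT => pn0.
have [a0 a0p] : exists a0, a0 \in msupp p.
  by move: pn0; rewrite -msupp_eq0; case: (msupp p) => // a s _; exists a; rewrite mem_head.
(* The polynomial whose value at [y] is [D l] of the value of [p] minus [chi l a0] times it. This
   value is again 0, and [a0] has left the support. *)
pose q l : {mpoly K[m]} := \sum_(a <- msupp p) (p@_a * (chi l a - chi l a0)) *: 'X_[a].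
have qE l b : (q l)@_b = p@_b * (chi l b - chi l a0).
  rewrite raddf_sum /=; have [bp|bp] := boolP (b \in msupp p); last first.
    rewrite big1_seq => [|a /= ap]; first by move: bp; rewrite -mcoeff_eq0 => /eqP ->; rewrite mul0r.
    rewrite mcoeffZ mcoeffX; case: eqP => [ab|]; last by rewrite mulr0.
    by move: bp; rewrite -ab ap.
  rewrite (bigD1_seq b) ?msupp_uniq //= big1 ?addr0 => [|a ab].
    by rewrite mcoeffZ mcoeffX eqxx mulr1.
  by rewrite mcoeffZ mcoeffX (negPf ab) mulr0.
have q0 l : q l = 0.
  apply: IH.
    apply: leq_trans hN; rewrite (perm_size (perm_to_rem a0p)) /= ltnS.
    apply: uniq_leq_size (msupp_uniq _) _ => b bq; rewrite mem_rem_uniq ?msupp_uniq //.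
    rewrite !inE; move: bq; rewrite mcoeff_msupp qE mulf_eq0 negb_or mcoeff_msupp.
    case/andP => -> /=; rewrite andbT; apply: contraNneq => ->.
    by rewrite subrr.
  have -> : mmap j y (q l) = D l (mmap j y p) - j (chi l a0) * mmap j y p.
    rewrite /mmap (der_sum (dD l)) mulr_sumr -sumrB -/(mmap j y (q l)) raddf_sum /=.
    apply: eq_bigr => a _; rewrite mmapZ mmapX (derM (dD l)) Dj Dm.
    by rewrite rmorphM rmorphB; ring.
  by rewrite p0 (der0 (dD l)) mulr0 subr0.
(* All [q l] being 0, every exponent in the support has the weights of [a0]. So [p] is a single
   term, which cannot vanish at nonzero [y i]. *)
have supp a : a \in msupp p -> a = a0.
  rewrite mcoeff_msupp => pa; apply: sep => l; apply/eqP.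
  have := congr1 (mcoeff a) (q0 l); rewrite qE mcoeff0 => /eqP.
  by rewrite mulf_eq0 (negPf pa) subr_eq0.
have pE : p = p@_a0 *: 'X_[a0].
  apply/mpolyP => b; rewrite mcoeffZ mcoeffX; case: eqP => [->|ab]; first by rewrite mulr1.
  rewrite mulr0; apply/eqP; rewrite mcoeff_eq0; apply/negP => /supp ba.
  by apply: ab.
move/eqP: p0; rewrite pE mmapZ mmapX mulf_eq0 fmorph_eq0.
rewrite -[p@_a0 == 0]negbK -mcoeff_msupp a0p /=.
by rewrite /mmap1 prodf_seq_eq0 => /hasP[i _ /=]; rewrite expf_eq0 (negPf (y0 i)) andbF.
Qed.

(** * Bases of the integer lattice adapted to the radical of [N] *)

Section Lattice.
Variables (k : fieldType) (n : nat) (N : 'M[k]_n) (T : {set 'I_n}).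
Hypothesis char0 : forall m, m.+1%:R != 0 :> k.
Local Notation ext M := (map_mx (intr : int -> k) M).

(** The rows of [sigma] form a lattice basis: those in [S] are supported on [T], the others lie in
    the left kernel of [N]. *)
Definition adapted (sigma : 'M[int]_n) (S : {set 'I_n}) : Prop :=
  [/\ sigma \in unitmx, (forall i l, i \in S -> l \notin T -> sigma i l = 0) &
      (forall i, i \notin S -> row i (ext sigma *m N) = 0)].

(** A nontrivial integral combination of the rows in [S] that lies in the left kernel of [N], an
    obstruction to distinct weights. *)
Definition relation (sigma : 'M[int]_n) (S : {set 'I_n}) (a : 'rV[int]_n) : Prop :=
  [/\ a != 0, (forall i, i \notin S -> a 0 i = 0) & ext a *m (ext sigma *m N) = 0].

Lemma intr_inj0 (z : int) : z%:~R = 0 :> k -> z = 0.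
Proof.
by case: z => [[|m]|m] //= /eqP; rewrite ?NegzE ?mulrNz ?oppr_eq0 -?pmulrn (negPf (char0 m)).
Qed.

(* Euclid's algorithm on the coefficients of the relation. *)
Lemma adapted_shrink sigma S a : adapted sigma S -> relation sigma S a ->
  exists sigma' S', adapted sigma' S' /\ (#|S'| < #|S|)%N.
Proof.
pose h (a : 'rV[int]_n) : nat := (\sum_i `|a 0%R i|)%N.
have [M] := ubnP (h a); elim: M sigma a => // M IH sigma a; rewrite ltnS => hM.
move=> adp [a0 aS rel]; have [su sT sN] := adp.
have [i ai] : exists i, a 0 i != 0.
  apply/existsP; apply: contraNT a0; rewrite negb_exists => /forallP z.
  by apply/eqP/rowP => i; rewrite mxE; apply/eqP; rewrite -[_ == _]negbK z.
have aS' i' : a 0 i' != 0 -> i' \in S by apply: contraR => /aS ->.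
(* With a single nonzero coefficient [a 0 i], characteristic zero puts row [i] itself into the left
   kernel, and [i] can leave [S]. *)
have [/existsP[j /andP[ij aj]]|] := boolP [exists j, (j != i) && (a 0 j != 0)]; last first.
  rewrite negb_exists => /forallP only.
  exists sigma, (S :\ i); split; last by rewrite (cardsD1 i S) aS'.
  split=> // [i' l|i'].
    by rewrite in_setD1 => /andP[_]; apply: sT.
  rewrite in_setD1 negb_and negbK => /orP[/eqP ->|]; last exact: sN.
  have : ext a *m (ext sigma *m N) = (a 0 i)%:~R *: row i (ext sigma *m N).
    apply/rowP => l; rewrite mxE (bigD1 i) //= big1 ?addr0 => [|j ji]; first by rewrite !mxE.
    by have := only j; rewrite ji /= negbK => /eqP aj; rewrite mxE aj mul0r.
  rewrite rel => /esym/eqP; rewrite scaler_eq0 => /orP[/eqP/intr_inj0 z|/eqP //].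
  by rewrite z eqxx in ai.
wlog le : i j ij ai aj / (`|a 0%R j| <= `|a 0%R i|)%N.
  move=> W; case: (leqP `|a 0%R j|%N `|a 0%R i|%N) => [|/ltnW] le; first exact: (W i j).
  by apply: (W j i) => //; rewrite eq_sym.
(* The sign for which subtracting [e] times [a 0 j] from [a 0 i] lowers its absolute value, hence
   the measure [h]. *)
pose e : int := if (0 <= a 0 i) == (0 <= a 0 j) then 1 else -1.
have ee : e * e = 1 by rewrite /e; case: ifP.
pose E (c : int) : 'M[int]_n := 1%:M + c *: delta_mx j i.
have EE c d : E c *m E d = E (c + d).
  rewrite /E mulmxDl mul1mx mulmxDr mulmx1 -scalemxAl -scalemxAr.
  rewrite mul_delta_mx_0 1?eq_sym // !scaler0 addr0 scalerDl.
  by rewrite -addrA; congr (_ + _); rewrite addrC.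
have E0 : E 0 = 1%:M by rewrite /E scale0r addr0.
have Eu c : E c \in unitmx.
  by have := EE c (- c); rewrite subrr E0 => /mulmx1_unit[].
pose sigma' := E e *m sigma; pose a' := a *m E (- e).
have sE r l : sigma' r l = sigma r l + (r == j)%:R * e * sigma i l.
  rewrite /sigma' mulmxDl mul1mx -scalemxAl mxE; congr (_ + _); rewrite !mxE.
  rewrite (bigD1 i) //= big1 ?addr0 => [|p pi]; rewrite mxE ?eqxx ?(negPf pi) ?andbT ?andbF.
    by rewrite mulrCA mulrA.
  by rewrite mul0r.
have aE l : a' 0 l = a 0 l - (l == i)%:R * e * a 0 j.
  rewrite /a' mulmxDr mulmx1 -scalemxAr mxE; congr (_ + _); rewrite !mxE.
  rewrite (bigD1 j) //= big1 ?addr0 => [|p pj]; rewrite mxE ?eqxx ?(negPf pj) ?andbT ?andbF.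
    by rewrite -mulNr; ring.
  by rewrite mulr0.
apply: (IH sigma' a').
- apply: leq_trans hM; rewrite /h (bigD1 i) //= [X in (_ < X)%N](bigD1 i) //=.
  rewrite (eq_bigr (fun l => `|a 0%R l|%N)) => [|l li]; last first.
    by rewrite aE (negPf li) !mul0r subr0.
  rewrite ltn_add2r aE eqxx /e; move: (a 0 i) (a 0 j) aj le => u v v0 uv.
  rewrite mulr1n mul1r.
  by case: (lerP 0 u) => hu; case: (lerP 0 v) => hv /=; lia.
- split=> [|r l rS lT|r rS].
  + by rewrite unitmx_mul Eu.
  + by rewrite sE sT // (sT i) ?aS' // mulr0 addr0.
  + rewrite row_mul -(sN r rS) row_mul; congr (_ *m _); apply/rowP => l.
    rewrite 2![LHS]mxE 2![RHS]mxE sE.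
    have -> : (r == j) = false by apply: contraNF rS => /eqP ->; apply: aS'.
    by rewrite !mul0r addr0.
- split=> [|r rS|].
  + apply: contraNneq aj => a'0; have := aE j; rewrite a'0 mxE (negPf ij) !mul0r subr0.
    by move=> <-.
  + rewrite aE aS //; have -> : (r == i) = false.
      by apply: contraNF rS => /eqP ->; apply: aS'.
    by rewrite !mul0r subr0.
  + rewrite mulmxA -map_mxM /a' /sigma' mulmxA -(mulmxA a) EE addNr E0 mulmx1.
    by rewrite map_mxM -mulmxA.
Qed.

Hypothesis NT : forall i, i \notin T -> row i N = 0.

(** Start from the standard basis with [S = T] and shrink [S] while a relation exists. *)
Lemma adapted_basis : exists sigma S, adapted sigma S /\
  forall a, ~ relation sigma S a.
Proof.
have base : adapted 1%:M T.
  split=> [|i l iT lT|i iT]; first exact: unitmx1.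
    by rewrite mxE; case: eqP => // il; rewrite il (negPf lT) in iT.
  by rewrite map_mx1 mul1mx NT.
suff gen M sigma (S : {set 'I_n}) : (#|S| < M)%N -> adapted sigma S ->
    exists sigma S, adapted sigma S /\ forall a, ~ relation sigma S a.
  exact: gen (ltnSn _) base.
elim: M sigma S => // M IH sigma S; rewrite ltnS => hM adp.
have [[a ra]|no] := excluded_middle_informative (exists a, relation sigma S a).
  have [sigma' [S' [adp' lt]]] := adapted_shrink adp ra.
  by apply: (IH sigma' S') => //; apply: leq_trans lt hM.
by exists sigma, S; split=> // a ra; apply: no; exists a.
Qed.

End Lattice.

(** Brings the basis vectors indexed by [S] to the front, so that [mu] becomes an upper left
    block. *)
Lemma perm_initial (n : nat) (S : {set 'I_n}) :
  exists s : 'S_n, forall i : 'I_n, (s i \in S) = (i < #|S|)%N.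
Proof.
pose t := enum S ++ enum (~: S).
have ut : uniq t.
  rewrite cat_uniq !enum_uniq /= andbT; apply/hasPn => i.
  by rewrite !mem_enum in_setC.
have st : size t = n by rewrite size_cat -!cardE cardsC card_ord.
pose f (i : 'I_n) := nth i t i.
have f_inj : injective f.
  move=> i j; rewrite /f (set_nth_default i) ?st // => /eqP.
  by rewrite nth_uniq ?st // => /eqP/val_inj.
exists (perm f_inj) => i; rewrite permE /f nth_cat -cardE.
case: ltnP => h; first by rewrite -mem_enum mem_nth // -cardE.
apply/negbTE; rewrite -in_setC -mem_enum mem_nth // -cardE.
by rewrite -(ltn_add2r #|S|) subnK // addnC cardsC card_ord.
Qed.

(** * Laurent monomials *)

Section Monomials.
Variables (L : fieldType) (n : nat) (v : 'I_n -> L).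
Hypothesis v_neq0 : forall l, v l != 0.

Definition zmonom (a : 'I_n -> int) : L := \prod_l v l ^ a l.

Lemma zmonom_neq0 a : zmonom a != 0.
Proof. by apply/prodf_neq0 => l _; apply: expfz_neq0. Qed.

(** Exponents compose by matrix multiplication, so an invertible [sigma] lets the [v l] be recovered
    from the monomials. *)
Lemma zmonom_prod (sigma : 'M[int]_n) (b : 'I_n -> int) :
  \prod_i zmonom (sigma i) ^ b i = zmonom (fun l => \sum_i b i * sigma i l).
Proof.
have powp z (f : 'I_n -> L) : (\prod_l f l) ^ z = \prod_l f l ^ z.
  by apply: (big_morph (fun x => x ^ z)) => [x y|]; rewrite ?expfzMl ?exp1rz.
under eq_bigr => i _ do rewrite /zmonom powp.
rewrite exchange_big; apply: eq_bigr => l _ /=.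
rewrite (big_morph (fun e : int => v l ^ e) (fun x y => expfzDr x y (v_neq0 l)) (expr0z _)).
by apply: eq_bigr => i _; rewrite exprz_exp mulrC.
Qed.

Lemma der_zmonom (D : L -> L) (c : 'I_n -> L) (a : 'I_n -> int) :
    is_der D -> (forall l, D (v l) = c l * v l) ->
  D (zmonom a) = (\sum_l c l *~ a l) * zmonom a.
Proof.
move=> dD Dv; rewrite /zmonom (@der_eigen_prod _ _ dD _ _ (fun l => c l *~ a l)) //.
by move=> l; apply: der_eigenXz.
Qed.

End Monomials.

Lemma qtorus_of_generators (k L : fieldType) (iL : {rmorphism k -> L})
    (brL : L -> L -> L) (n : nat) (lambda : 'M[k]_n) (w : 'I_n -> L) :
    (forall m, m.+1%:R != 0 :> k) ->
    poisson_bracket iL brL -> lambda^T = - lambda -> generates iL w ->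
    (forall i j, brL (w i) (w j) = iL (lambda i j) * w i * w j) ->
  exists (K : fieldType) (iK : {rmorphism k -> K}) (m : nat) (hm : (m <= n)%N)
         (mu : 'M[k]_m) (sigma : 'M[int]_n),
    [/\ mu^T = - mu,
        sigma \in unitmx,
        (forall i j : 'I_m,
           mu i j = (map_mx intr sigma *m lambda *m (map_mx intr sigma)^T)
                      (widen_ord hm i) (widen_ord hm j)) &
        exists (brT : ratfun K m -> ratfun K m -> ratfun K m)
               (f : L -> ratfun K m),
          qtorus_bracket (map_mx iK mu) brT /\
          poisson_iso iL (fun c : k => @ratfunC K m (iK c)) brL brT f].
Proof.
move=> char0 pbrL lambda_anti gen rel.
have brr := br_der pbrL; have brl := br_derl pbrL.
pose T := [set i | w i != 0].
(* Replacing vanishing generators by 1 makes Laurent monomials legitimate; correspondingly [N] is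
   [lambda] with the rows and columns outside [T] set to 0. *)
pose v i := if w i == 0 then 1 else w i.
have v0 i : v i != 0 by rewrite /v; case: ifP => [_|/negbT //]; apply: oner_neq0.
pose N : 'M[k]_n := \matrix_(i, j) if (i \in T) && (j \in T) then lambda i j else 0.
have relv i j : brL (v i) (v j) = iL (N i j) * v i * v j.
  rewrite mxE !inE /v; case: eqVneq => /= wi; first by rewrite rmorph0 !mul0r (der1 (brl _)).
  by case: eqVneq => /= wj; rewrite ?rmorph0 ?mul0r ?(der1 (brr _)).
have genv : generates iL v.
  move=> F sF Fk Fv; apply: gen => // i; have := Fv i; rewrite /v.
  by case: eqP => // -> _; apply: subfield_pred0.
have NT i : i \notin T -> row i N = 0.
  by move=> iT; apply/rowP => l; rewrite !mxE (negPf iT).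
have [sg0 [S [[su0 sT0 sN0] indep0]]] := adapted_basis char0 NT.
have [pi piS] := perm_initial S.
pose m := #|S|; have hm : (m <= n)%N by rewrite -[n in (_ <= n)%N]card_ord max_card.
pose sg : 'M[int]_n := row_perm pi sg0.
pose es : 'M[k]_n := map_mx intr sg.
have sgE i l : sg i l = sg0 (pi i) l by rewrite mxE.
have su : sg \in unitmx by rewrite /sg row_permE unitmx_mul unitmx_perm.
have sT (i : 'I_n) l : (i < m)%N -> l \notin T -> sg i l = 0.
  by move=> im lT; rewrite sgE sT0 // piS.
have rowE i l : (es *m N) i l = (map_mx intr sg0 *m N) (pi i) l.
  by rewrite !mxE; apply: eq_bigr => j _; rewrite !mxE.
have sN (i : 'I_n) l : (m <= i)%N -> (es *m N) i l = 0.
  move=> mi; have : pi i \notin S by rewrite piS -leqNgt.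
  by move/sN0/rowP/(_ l); rewrite rowE !mxE.
pose y i := zmonom v (sg i).
have y0 i : y i != 0 by apply: zmonom_neq0.
have bry_v i l : brL (y i) (v l) = iL ((es *m N) i l) * y i * v l.
  rewrite (der_zmonom (D := brL^~ (v l)) (c := fun p => iL (N p l) * v l)) //; last first.
    by move=> p; rewrite relv; ring.
  have -> : \sum_p (iL (N p l) * v l) *~ sg i p = iL ((es *m N) i l) * v l.
    rewrite mxE rmorph_sum mulr_suml; apply: eq_bigr => p _.
    by rewrite [es i p]mxE rmorphM rmorph_int -mulrzl mulrA.
  by rewrite -/(y i); ring.
(* The Poisson center, which becomes [K]; it contains the monomials [y i] with [m <= i], whose
   exponents lie in the left kernel of [N]. *)
pose cent z := forall x, brL z x = 0.
have sC : subfield_pred cent.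
  split=> [x|a b ca cb x|a b ca cb x|a ca x].
  - exact: (der1 (brl _)).
  - by rewrite (derD (brl _)) (derN (brl _)) ca cb subr0.
  - by rewrite (derM (brl _)) ca cb mul0r mulr0 addr0.
  - by rewrite (derV (brl _)) ca oppr0 mul0r.
have kC c : cent (iL c) by move=> x; rewrite (brC pbrL) (br_const pbrL) oppr0.
have yC (i : 'I_n) : (m <= i)%N -> cent (y i).
  move=> mi; apply: genv (subfield_pred_ker (brr (y i))) _ _ => [c|l].
    exact: (br_const pbrL).
  by rewrite bry_v sN // rmorph0 !mul0r.
pose mu : 'M[k]_m := \matrix_(i, j) (es *m lambda *m es^T) (widen_ord hm i) (widen_ord hm j).
(* The first [m] rows of [sg] are supported on [T], where [N] and [lambda] agree. *)
have muE i j : (es *m N *m es^T) (widen_ord hm i) (widen_ord hm j) = mu i j.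
  rewrite !mxE; apply: eq_bigr => q _; rewrite [es^T _ _]mxE.
  have [qT|qT] := boolP (q \in T); last by rewrite [es _ q]mxE (sT _ q) //= !mulr0.
  congr (_ * _); rewrite !mxE; apply: eq_bigr => p _.
  have [pT|pT] := boolP (p \in T); first by rewrite !mxE pT qT.
  by rewrite [es _ p]mxE (sT _ p) //= !mul0r.
have bry i j : brL (y i) (y j) = iL ((es *m N *m es^T) i j) * y i * y j.
  rewrite (der_zmonom (D := brL (y i)) (c := fun l => iL ((es *m N) i l) * y i)) //.
  rewrite -/(y j); congr (_ * _); rewrite mxE rmorph_sum mulr_suml.
  apply: eq_bigr => l _; rewrite [es^T _ _]mxE [es j l]mxE rmorphM rmorph_int -mulrzl.
  by ring.
pose K : fieldType := subfield sC.
pose iK : {rmorphism k -> K} := subfield_cores sC kC.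
pose j : {rmorphism K -> L} := @subfield_val L cent sC.
exists K, iK, m, hm, mu, sg; split=> //.
- apply/matrixP => a b; rewrite mxE [LHS]mxE [RHS]mxE [in RHS]mxE.
  have anti : (es *m lambda *m es^T)^T = - (es *m lambda *m es^T).
    by rewrite !trmx_mul trmxK lambda_anti mulNmx mulmxN mulmxA.
  by have /matrixP/(_ (widen_ord hm a) (widen_ord hm b)) := anti; rewrite mxE [RHS]mxE.
- by move=> a b; rewrite [LHS]mxE.
apply: (@qtorus_iso k K L iL iK j brL m mu (fun i => y (widen_ord hm i))) => //.
- by move=> c z; apply: (subfield_valP c).
- move=> F sF Fj Fy.
  have Fyn i : F (y i).
    case: (ltnP i m) => im.
      by have := Fy (Ordinal im); congr (F (y _)); apply: val_inj.
    exact: (Fj (subfield_in sC (yC _ im))).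
  apply: genv => // [c|l]; first exact: (Fj (iK c)).
  have -> : v l = \prod_i y i ^ (invmx sg l i).
    have inv p : \sum_i invmx sg l i * sg i p = (l == p)%:R.
      by have /matrixP/(_ l p) := mulVmx su; rewrite [LHS]mxE [RHS]mxE.
    rewrite zmonom_prod // /zmonom (bigD1 l) //= inv eqxx expr1z big1 ?mulr1 // => p pl.
    by rewrite inv eq_sym (negPf pl) expr0z.
  by apply: subfield_pred_prod => // i _; apply: subfield_predXz.
(* The logarithmic derivations [{-, v l} / v l] kill the center and have each [y i] as an
   eigenvector with scalar weight. *)
- apply: (@weights_indep K L j m _ 'I_n (fun l z => (v l)^-1 * brL z (v l))
     (fun i l => iK ((es *m N) (widen_ord hm i) l))) => //.
  + move=> l; split=> a b; first by rewrite (derD (brl _)) mulrDr.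
    by rewrite (derM (brl _)); ring.
  + by move=> l a; rewrite (subfield_valP a) mulr0.
  + move=> l i; rewrite bry_v /= ; field; exact: v0.
  + move=> a b ab.
    (* The difference of the exponents, extended by 0 beyond [m] and carried back along [pi]; were
       it nonzero, equality of all weights would make it a [relation]. *)
    pose dd (i : 'I_n) : int :=
      if insub (i : nat) is Some i' then (a i')%:Z - (b i')%:Z else 0.
    have ddE i : dd (widen_ord hm i) = (a i)%:Z - (b i)%:Z.
      by rewrite /dd /= valK.
    have dd0 (i : 'I_n) : ~~ (i < m)%N -> dd i = 0.
      by move=> im; rewrite /dd insubF //; apply: negbTE.
    pose d : 'rV[int]_n := \row_r dd ((pi^-1)%g r).
    have dE i : d 0 (pi i) = dd i by rewrite mxE permK.
    apply/mnmP => i; apply/eqP; apply: contraT => nab; case: (indep0 d); split.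
    * apply: contraNneq nab => d0; have := dE (widen_ord hm i).
      by rewrite d0 ddE mxE => /esym/eqP; rewrite subr_eq0.
    * by move=> r rS; rewrite mxE dd0 // -piS permKV.
    apply/rowP => l; rewrite mxE (reindex_inj (@perm_inj _ pi)) /= [RHS]mxE.
    rewrite (bigID (fun i : 'I_n => (i < m)%N)) /= [X in _ + X]big1 ?addr0; last first.
      by move=> p pm; rewrite mxE dE dd0 // mul0r.
    rewrite (big_ord_narrow hm); apply: (fmorph_inj iK).
    rewrite rmorph_sum rmorph0 -[RHS](subrr (\sum_p iK ((es *m N) (widen_ord hm p) l) *+ a p)).
    rewrite [in X in _ = _ - X]ab -sumrB; apply: eq_bigr => p _.
    rewrite -rowE [(map_mx _ _) _ _]mxE dE ddE rmorphM rmorph_int.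
    rewrite intrB -!pmulrn mulrBl !mulr_natl.
    by [].
- move=> a b; rewrite bry muE //.
Qed.

Unset Implicit Arguments.

Theorem theorem3p9 (k : fieldType) (n : nat)
    (br : {mpoly k[n]} -> {mpoly k[n]} -> {mpoly k[n]})
    (alpha delta : 'I_n -> {mpoly k[n]} -> {mpoly k[n]})
    (s : 'I_n -> k) (lambda : 'M[k]_n) :
  (* char k = 0 *)
  [pchar k] =i pred0 ->
  (* A = k[x_1][x_2;alpha_2,delta_2]_p ... [x_n;alpha_n,delta_n]_p *)
  iterated_poisson_poly br alpha delta ->
  (* (a) each delta_i is locally nilpotent on k[x_1,...,x_{i-1}] *)
  (forall (i : 'I_n) (b : {mpoly k[n]}), lower_vars i b ->
     exists N : nat, iter N (delta i) b = 0) ->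
  (* (b) alpha_i delta_i = delta_i (alpha_i + s_i), s_i in k^x *)
  (forall i : 'I_n, s i != 0) ->
  (forall (i : 'I_n) (b : {mpoly k[n]}), lower_vars i b ->
     alpha i (delta i b) = delta i (alpha i b + s i *: b)) ->
  (* (c) alpha_i(x_j) = lambda_ij x_j for i > j; lambda antisymmetric *)
  lambda^T = - lambda ->
  (forall i j : 'I_n, (j < i)%N -> alpha i 'X_j = lambda i j *: 'X_j) ->
  (* (1) Fract A = k_lambda(y_1,...,y_n) as Poisson algebras *)
  (forall brF : ratfun k n -> ratfun k n -> ratfun k n,
     poisson_bracket (@ratfunC k n) brF ->
     (forall a b : {mpoly k[n]},
        brF (@FracField.tofrac _ a) (@FracField.tofrac _ b)
        = @FracField.tofrac _ (br a b)) ->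
     exists (brT : ratfun k n -> ratfun k n -> ratfun k n)
            (f : ratfun k n -> ratfun k n),
       qtorus_bracket lambda brT /\
       poisson_iso (@ratfunC k n) (@ratfunC k n) brF brT f)
  /\
  (* (2) for every Poisson prime P, Fract(A/P) = K_mu(y_1,...,y_m);        *)
  (* Fract(A/P) is presented as a field L with a k-algebra map phi : A -> L *)
  (* of kernel P whose image generates L as a field, with the bracket on L  *)
  (* induced from A.                                                      *)
  (forall (P : {mpoly k[n]} -> Prop), poisson_prime_ideal br P ->
   forall (L : fieldType) (iL : {rmorphism k -> L})
          (phi : {rmorphism {mpoly k[n]} -> L})
          (brL : L -> L -> L),
     (forall c : k, phi c%:MP = iL c) ->
     (forall a, phi a = 0 <-> P a) ->
     (forall z : L, exists a b, phi b != 0 /\ z = phi a / phi b) ->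
     poisson_bracket iL brL ->
     (forall a b, phi (br a b) = brL (phi a) (phi b)) ->
     exists (K : fieldType) (iK : {rmorphism k -> K}) (m : nat) (hm : (m <= n)%N)
            (mu : 'M[k]_m) (sigma : 'M[int]_n),
       [/\ mu^T = - mu,
           sigma \in unitmx,
           (forall i j : 'I_m,
              mu i j = (map_mx intr sigma *m lambda *m (map_mx intr sigma)^T)
                         (widen_ord hm i) (widen_ord hm j)) &
           exists (brT : ratfun K m -> ratfun K m -> ratfun K m)
                  (f : L -> ratfun K m),
             qtorus_bracket (map_mx iK mu) brT /\
             poisson_iso iL (fun c : k => @ratfunC K m (iK c)) brL brT f]).
Proof.
move=> /pcharf0P pchar0 itA nilp s_neq0 alpha_delta lambda_anti alphaX.
have char0 m : m.+1%:R != 0 :> k by rewrite pchar0.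
have gens := quasi_commuting_generators char0 itA nilp s_neq0 alpha_delta
  lambda_anti alphaX.
split=> [brF pF brFE|P _ L iL phi brL phiC _ phi_gen pL phi_br]; last first.
  have [w [gen rel]] := gens L iL brL pL phi phiC phi_gen phi_br.
  exact: qtorus_of_generators char0 pL lambda_anti gen rel.
pose tf : {rmorphism {mpoly k[n]} -> ratfun k n} := @FracField.tofrac {mpoly k[n]}.
pose iF : {rmorphism k -> ratfun k n} := tf \o @mpolyC n k.
have tf_gen (z : ratfun k n) : exists a b, tf b != 0 /\ z = tf a / tf b.
  exists (frac_num z), (frac_den z); split; last exact: fracE.
  by rewrite tofrac_eq0 frac_den_neq0.
have tf_br a b : tf (br a b) = brF (tf a) (tf b) by rewrite brFE.
have [w [gen rel]] := gens _ iF brF pF tf (fun=> erefl) tf_gen tf_br.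
have iFE c : iF c = ratfunC n c by [].
have cF c z : brF (iF c) z = 0.
  by rewrite (brC (iR := iF) pF) (br_const (iR := iF) pF) oppr0.
have indep := generators_indep char0 iFE gen.
(* Here [K] is [k] with the identity embedding, since [n] generators of [Fract A] are already
   independent over [k]. *)
have [brT [f [qT iso]]] := @qtorus_iso k k (ratfun k n) iF idfun iF brF n lambda w
  pF (fun=> erefl) cF gen indep rel.
by exists brT, f; split=> //; move: qT; rewrite map_mx_id.
Qed.
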